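(* Consider the decentralized saddle-point problem with consensus constraints, its penalized form $F_R$, the operators $H$, $G$, the constants $R_\alpha,R_\beta,\chi,D$ and the decentralized mirror-prox sliding (MPS) method, all described in the context. Suppose there exist constants $\delta,M\ge0$ such that for any $\mathbf z_1,\mathbf z_2,\mathbf z_3\in Z_m$ $$\langle H(\mathbf z_1)-H(\mathbf z_2),\mathbf z_1-\mathbf z_3\rangle\le\frac M2\|\mathbf z_1-\mathbf z_2\|^2+\frac M2\|\mathbf z_1-\mathbf z_3\|^2+\delta,$$ and let $\varepsilon\ge\delta$, $\varepsilon>0$. Suppose the parameters of the method are $$\gamma_k=\frac2{k+1},\quad\beta_k=\frac{2L}k,\quad T_k=\left\lceil\frac{kM}L\right\rceil,\quad\eta_k^t=\beta_k(t-1)+\frac{LT_k}k,\qquad\text{where } L=\frac{2D^2}{\varepsilon}\chi .$$ Then, in order to compute an approximate solution $\overline{\mathbf z}_N=(\overline{\mathbf x}_N,\overline{\mathbf y}_N)$ such that $$\max_{\mathbf y\in Y_m,\ \mathbf W_y\mathbf y=\mathbf 0}F(\overline{\mathbf x}_N,\mathbf y)-\min_{\mathbf x\in X_m,\ \mathbf W_x\mathbf x=\mathbf 0}F(\mathbf x,\overline{\mathbf y}_N)\le2\varepsilon,\qquad \|\mathbf W_x\overline{\mathbf x}_N\|\le\frac{2\varepsilon}{R_\alpha},\qquad\|\mathbf W_y\overline{\mathbf y}_N\|\le\frac{2\varepsilon}{R_\beta},$$ the number of communication rounds and the number of gradient calculations of $F$ are bounded respectively by $$N_{\text{rounds}}=O\left(\frac{D\,\Omega_{z_0}}{\varepsilon}\sqrt\chi\right),\qquad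 N_{\nabla F}=O\left(\frac{M\Omega_{z_0}^2+D\,\Omega_{z_0}\sqrt\chi}{\varepsilon}\right),$$ where $\Omega_{z_0}^2=\sup_{\mathbf z\in Z_m}V(\mathbf z_0,\mathbf z)$.
   Context: Problem. $X\subset\mathbb R^{d_x}$, $Y\subset\mathbb R^{d_y}$ are closed convex bounded sets; $f_1,\dots,f_m$ are convex-concave (possibly non-smooth) functions on $X\times Y$, $f_i$ being stored at node $i$ of a connected undirected graph with $m$ nodes and edge set $\mathcal E$. Let $\mathbf x=(x_1,\dots,x_m)$, $\mathbf y=(y_1,\dots,y_m)$ be stacked vectors, $X_m=X^m$, $Y_m=Y^m$, $Z=X\times Y$, $Z_m=\{\mathbf z=(\mathbf x,\mathbf y):\mathbf x\in X_m,\mathbf y\in Y_m\}$ and $F(\mathbf x,\mathbf y)=\sum_{i=1}^mf_i(x_i,y_i)$. The problem is $\min_{\mathbf x\in X_m}\max_{\mathbf y\in Y_m}F(\mathbf x,\mathbf y)$ subject to $x_1=\dots=x_m$, $y_1=\dots=y_m$. Gossip matrices. $\widetilde W_x,\widetilde W_y\in\mathbb R^{m\times m}$ are symmetric positive semidefinite, have zero $(i,j)$ entry whenever $i\ne j$ and $(i,j)\notin\mathcal E$, and their kernel is exactly the set of vectors with all coordinates equal. $\mathbf W_x=(\widetilde W_x\otimes\mathbf I_{d_x})^{1/2}$, $\mathbf W_y=(\widetilde W_y\otimes\mathbf I_{d_y})^{1/2}$. So consensus is equivalent to $\mathbf W_x\mathbf x=\mathbf 0$, $\mathbf W_y\mathbf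 y=\mathbf 0$. $\lambda_{\max}$ and $\lambda_{\min}^+$ denote the largest and the smallest positive eigenvalue. Penalization. $F_R(\mathbf x,\mathbf y)=F(\mathbf x,\mathbf y)+\frac{R_\alpha^2}{\varepsilon}\|\mathbf W_x\mathbf x\|_2^2-\frac{R_\beta^2}{\varepsilon}\|\mathbf W_y\mathbf y\|_2^2$. With $f(\mathbf x)=\max_{\mathbf y\in Y_m}F_R(\mathbf x,\mathbf y)$, $\mathbf x^*=\operatorname{argmin}_{\mathbf x\in X_m,\mathbf W_x\mathbf x=\mathbf 0}f(\mathbf x)$, $\mathbf y^*(\mathbf x)=\operatorname{argmax}_{\mathbf y\in Y_m,\mathbf W_y\mathbf y=\mathbf 0}F_R(\mathbf x,\mathbf y)$, $g_{\mathbf x}(\mathbf y)=F(\mathbf x,\mathbf y)$, the coefficients are $$R_\alpha^2=\frac{\sup_{\mathbf v\in\partial f(\mathbf x^* )}\|\mathbf v\|^2}{\lambda_{\min}^+(\mathbf W_x^\top\mathbf W_x)},\qquad R_\beta^2=\sup_{\mathbf x\in X_m}\frac{\sup_{\mathbf v\in\partial(-g_{\mathbf x})(\mathbf y^*(\mathbf x))}\|\mathbf v\|^2}{\lambda_{\min}^+(\mathbf W_y^\top\mathbf W_y)} .$$ (The value of $R_\alpha$ does not depend on the penalty term in $\mathbf x$, whose gradient vanishes at $\mathbf x^*$.) Constants. $\chi_\bullet=\lambda_{\max}(\mathbf W_\bullet^\top\mathbf W_\bullet)/\lambda^+_{\min}(\mathbf W_\bullet^\top\mathbf W_\bullet)$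 for $\bullet\in\{x,y\}$, $\chi=\max(\chi_x,\chi_y)$, and $D=\max\bigl(\|\nabla f(\mathbf x^* )\|,\ \sup_{\mathbf x\in X_m}\|\nabla F(\mathbf x,\mathbf y^*(\mathbf x))\|\bigr)$, where the norm of a (sub)gradient is understood as the largest norm over all subgradients at that point (assumed finite). Operators. $H(\mathbf z)=(\nabla_{\mathbf x}F(\mathbf x,\mathbf y),-\nabla_{\mathbf y}F(\mathbf x,\mathbf y))$, where $\nabla_{\mathbf x}F$ is some subgradient of $F(\cdot,\mathbf y)$ at $\mathbf x$ and $-\nabla_{\mathbf y}F$ is some subgradient of $-F(\mathbf x,\cdot)$ at $\mathbf y$; $G(\mathbf z)=\frac{R_\alpha^2}\varepsilon\|\mathbf W_x\mathbf x\|_2^2+\frac{R_\beta^2}\varepsilon\|\mathbf W_y\mathbf y\|_2^2$. $H_i$ is the component of $H$ at node $i$ (depends only on $z_i=(x_i,y_i)$). Bregman divergence. $\|\cdot\|$ is the $\ell_2$-norm, $d$ is a (differentiable) $1$-strongly convex prox-function on $Z$, $V(x,y)=d(y)-d(x)-\langle\nabla d(x),y-x\rangle$, and $V(\mathbf z,\mathbf z')=\sum_{i=1}^mV(z_i,z_i')$ for $\mathbf z,\mathbf z'\in Z_m$. Decentralized MPS method. Input: $\mathbf z_0\in Z_m$, number $N$ of outer steps, parameters $T_k,\beta_k,\eta_k^t,\gamma_k$. Set $\overline{\mathbf z}_0=\mathbf z_0$. For $k=1,\dots,N$: set $\underline{\mathbf z}_k=(1-\gamma_k)\overline{\mathbf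 z}_{k-1}+\gamma_k\mathbf z_{k-1}$, $\mathbf z_k^0=\mathbf z_{k-1}$, and compute $\underline{\mathbf G}_k=\nabla G(\underline{\mathbf z}_k)$ (with node components $\underline G_{i,k}$) by one communication round; for $t=1,\dots,T_k$ each node $i=1,\dots,m$ computes independently $$\tilde z_{i,k}^t=\operatorname*{argmin}_{z\in Z}\langle\underline G_{i,k}+H_i(z_{i,k}^{t-1}),z\rangle+\beta_kV(z_{i,k-1},z)+\eta_k^tV(z_{i,k}^{t-1},z),$$ $$z_{i,k}^t=\operatorname*{argmin}_{z\in Z}\langle\underline G_{i,k}+H_i(\tilde z_{i,k}^{t}),z\rangle+\beta_kV(z_{i,k-1},z)+\eta_k^tV(z_{i,k}^{t-1},z);$$ then $\mathbf z_k=\mathbf z_k^{T_k}$, $\tilde{\mathbf z}_k=\frac1{T_k}\sum_{t=1}^{T_k}\tilde{\mathbf z}_k^t$, $\overline{\mathbf z}_k=(1-\gamma_k)\overline{\mathbf z}_{k-1}+\gamma_k\tilde{\mathbf z}_k$. Output: $\overline{\mathbf z}_N$. One gradient calculation of $F$ means one evaluation of $H$ (one subgradient call per node). $O(\cdot)$ hides absolute constants; as counts are positive integers, the bounds are understood in the regime where $D\Omega_{z_0}\sqrt\chi/\varepsilon\ge1$. *)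

(* Defs.v *)
From HB Require Import structures.
From mathcomp Require Import all_boot all_order all_algebra.
From mathcomp Require Import all_classical all_reals all_analysis.
From mathcomp Require Import mxtens.

Set Implicit Arguments.
Unset Strict Implicit.
Unset Printing Implicit Defensive.

Import Order.TTheory GRing.Theory Num.Theory.
Import numFieldNormedType.Exports.

Local Open Scope classical_set_scope.
Local Open Scope ring_scope.

Section Euclidean.
Context {R : realType}.

(* The library norm on matrices is the sup norm, hence these l2 versions. *)
Definition dotm p q (a b : 'M[R]_(p, q)) : R := \sum_i \sum_j a i j * b i j.

Definition norm2 p q (a : 'M[R]_(p, q)) : R := Num.sqrt (dotm a a).

Definition dotz p dx dy (z w : 'M[R]_(p, dx) * 'M[R]_(p, dy)) : R :=
  dotm z.1 w.1 + dotm z.2 w.2.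

Definition norm2z p dx dy (z : 'M[R]_(p, dx) * 'M[R]_(p, dy)) : R :=
  Num.sqrt (dotz z z).

Definition is_argmin (T : Type) (A : set T) (g : T -> R) (a : T) : Prop :=
  A a /\ forall b, A b -> g a <= g b.

Definition is_argmax (T : Type) (A : set T) (g : T -> R) (a : T) : Prop :=
  A a /\ forall b, A b -> g b <= g a.

(* Subdifferential at a of a function g with domain A; values of g outside A
   play no role. *)
Definition subdiff p q (A : set 'M[R]_(p, q)) (g : 'M[R]_(p, q) -> R)
    (a : 'M[R]_(p, q)) : set 'M[R]_(p, q) :=
  [set v | forall b, A b -> g a + dotm v (b - a) <= g b].

(* v is a (Frechet) gradient at z of g restricted to A; it is unique when z is
   in the interior of A. *)
Definition is_gradient p dx dy (A : set ('M[R]_(p, dx) * 'M[R]_(p, dy)))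
    (g : 'M[R]_(p, dx) * 'M[R]_(p, dy) -> R)
    (z v : 'M[R]_(p, dx) * 'M[R]_(p, dy)) : Prop :=
  (fun w => (g w - g z - dotz v (w - z)) / norm2z (w - z))
    @ within A z^' --> (0 : R).

(* 1-strong convexity with respect to the l2-norm. *)
Definition strongly_convex1 p dx dy (A : set ('M[R]_(p, dx) * 'M[R]_(p, dy)))
    (g : 'M[R]_(p, dx) * 'M[R]_(p, dy) -> R) : Prop :=
  forall z w (s : R), A z -> A w -> 0 <= s <= 1 ->
    g (s *: z + (1 - s) *: w) <=
      s * g z + (1 - s) * g w - 2^-1 * (s * (1 - s)) * norm2z (z - w) ^+ 2.

Definition psd n (W : 'M[R]_n) : Prop :=
  W^T = W /\ forall v : 'cV[R]_n, 0 <= (v^T *m W *m v) 0 0.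

Definition is_psd_sqrt n (A S : 'M[R]_n) : Prop := psd S /\ S *m S = A.

Definition lambda_max n (A : 'M[R]_n) : R := sup [set l | eigenvalue A l].

Definition lambda_minp n (A : 'M[R]_n) : R :=
  inf [set l | 0 < l /\ eigenvalue A l].

Definition cond_number n (W : 'M[R]_n) : R :=
  lambda_max (W^T *m W) / lambda_minp (W^T *m W).

End Euclidean.

Section Network.
Context {R : realType} {m : nat}.

Definition connected_graph (e : rel 'I_m) : Prop :=
  [/\ symmetric e, irreflexive e & forall i j, connect e i j].

Definition gossip_matrix (e : rel 'I_m) (W : 'M[R]_m) : Prop :=
  [/\ psd W,
      forall i j, i != j -> ~~ e i j -> W i j = 0
    & forall v : 'cV[R]_m, W *m v = 0 <-> exists c : R, v = const_mx c].

(* The stacked vector (x_1, ..., x_m) is kept as the matrix with rows x_i;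
   [flat] turns it into a column, with the indexing used by [*t]. *)
Definition flat q (x : 'M[R]_(m, q)) : 'cV[R]_(m * q) :=
  \col_k x (mxtens_unindex k).1 (mxtens_unindex k).2.

Definition mulW q (W : 'M[R]_(m * q)) (x : 'M[R]_(m, q)) : 'cV[R]_(m * q) :=
  W *m flat x.

Definition stacked q (A : set 'rV[R]_q) : set 'M[R]_(m, q) :=
  [set x | forall i, A (row i x)].

Definition consensus q (A : set 'rV[R]_q) (W : 'M[R]_(m * q)) :
    set 'M[R]_(m, q) :=
  [set x | stacked A x /\ mulW W x = 0].

End Network.

Section SaddlePoint.
Context {R : realType} {m dx dy : nat}.
Notation point := ('rV[R]_dx * 'rV[R]_dy)%type.
Notation stack := ('M[R]_(m, dx) * 'M[R]_(m, dy))%type.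

(* f is convex-concave on U `*` V. *)
Definition convex_concave (U : set 'rV[R]_dx) (V : set 'rV[R]_dy)
    (f : 'rV[R]_dx -> 'rV[R]_dy -> R) : Prop :=
  (forall y, V y -> convex_function U (fun x => f x y)) /\
  (forall x, U x -> convex_function V (fun y => - f x y)).

Definition sum_cost (f : 'I_m -> 'rV[R]_dx -> 'rV[R]_dy -> R)
    (x : 'M[R]_(m, dx)) (y : 'M[R]_(m, dy)) : R :=
  \sum_i f i (row i x) (row i y).

(* Pairs (v, w) with v in the subdifferential of F(., y) at x and w in that of
   - F(x, .) at y, F having domain U^m x V^m. *)
Definition saddle_subdiff (U : set 'rV[R]_dx) (V : set 'rV[R]_dy)
    (F : 'M[R]_(m, dx) -> 'M[R]_(m, dy) -> R) (x : 'M[R]_(m, dx))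
    (y : 'M[R]_(m, dy)) : set stack :=
  subdiff (stacked U) (fun x' => F x' y) x `*`
  subdiff (stacked V) (fun y' => - F x y') y.

Section Penalty.
Context (Wx : 'M[R]_(m * dx)) (Wy : 'M[R]_(m * dy)) (Ra Rb eps : R).

Definition penalized (F : 'M[R]_(m, dx) -> 'M[R]_(m, dy) -> R) x y : R :=
  F x y + Ra ^+ 2 / eps * norm2 (mulW Wx x) ^+ 2
        - Rb ^+ 2 / eps * norm2 (mulW Wy y) ^+ 2.

Definition penalty (z : stack) : R :=
  Ra ^+ 2 / eps * norm2 (mulW Wx z.1) ^+ 2
  + Rb ^+ 2 / eps * norm2 (mulW Wy z.2) ^+ 2.

End Penalty.

Definition max_over (Y : set 'rV[R]_dy)
    (Phi : 'M[R]_(m, dx) -> 'M[R]_(m, dy) -> R) (x : 'M[R]_(m, dx)) : R :=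
  sup [set Phi x y | y in stacked Y].

Definition node (z : stack) (i : 'I_m) : point := (row i z.1, row i z.2).

Definition operator (h : 'I_m -> point -> point) (z : stack) : stack :=
  (\matrix_(i < m) (h i (node z i)).1, \matrix_(i < m) (h i (node z i)).2).

Section Bregman.
Context (d : point -> R) (gd : point -> point).

Definition bregman (z w : point) : R := d w - d z - dotz (gd z) (w - z).

Definition bregman_sum (z w : stack) : R :=
  \sum_i bregman (node z i) (node w i).

End Bregman.

(* Decentralized mirror-prox sliding. zu, z, zt, zb are the underlined, plain,
   tilded (averaged) and overlined outer sequences, zin k t = z_k^t and
   ztin k t = \tilde z_k^t the inner ones, gG k = \nabla G (zu k). Only outer
   indices k <= N and inner indices t <= T k are constrained. *)
Record mps_run (Z : set point) (V : point -> point -> R)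
    (h : 'I_m -> point -> point) (G : stack -> R)
    (T : nat -> nat) (beta gamma : nat -> R) (eta : nat -> nat -> R)
    (z0 : stack) (N : nat)
    (zu z zt zb gG : nat -> stack) (zin ztin : nat -> nat -> stack) : Prop :=
  MpsRun {
    mps_z0 : z 0%N = z0;
    mps_zb0 : zb 0%N = z0;
    mps_zu : forall k, (0 < k <= N)%N ->
      zu k = (1 - gamma k) *: zb k.-1 + gamma k *: z k.-1;
    mps_gG : forall k, (0 < k <= N)%N -> is_gradient setT G (zu k) (gG k);
    mps_zin0 : forall k, (0 < k <= N)%N -> zin k 0%N = z k.-1;
    mps_ztin : forall k t i, (0 < k <= N)%N -> (0 < t <= T k)%N ->
      is_argmin Z
        (fun w => dotz (node (gG k) i + h i (node (zin k t.-1) i)) w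
                  + beta k * V (node (z k.-1) i) w
                  + eta k t * V (node (zin k t.-1) i) w)
        (node (ztin k t) i);
    mps_zin : forall k t i, (0 < k <= N)%N -> (0 < t <= T k)%N ->
      is_argmin Z
        (fun w => dotz (node (gG k) i + h i (node (ztin k t) i)) w
                  + beta k * V (node (z k.-1) i) w
                  + eta k t * V (node (zin k t.-1) i) w)
        (node (zin k t) i);
    mps_z : forall k, (0 < k <= N)%N -> z k = zin k (T k);
    mps_zt : forall k, (0 < k <= N)%N ->
      zt k = (T k)%:R^-1 *: \sum_(1 <= t < (T k).+1) ztin k t;
    mps_zb : forall k, (0 < k <= N)%N ->
      zb k = (1 - gamma k) *: zb k.-1 + gamma k *: zt k
  }.

End SaddlePoint.

(* One round per outer step, to compute gG k. *)
Definition nb_rounds (N : nat) : nat := (\sum_(1 <= k < N.+1) 1)%N.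

(* Each inner step evaluates the operator twice: at z_k^(t-1) and at
   \tilde z_k^t. *)
Definition nb_grads (T : nat -> nat) (N : nat) : nat :=
  (\sum_(1 <= k < N.+1) \sum_(1 <= t < (T k).+1) 2)%N.

Section StepSizes.
Context {R : realType} (L M : R).

Definition mps_gamma (k : nat) : R := 2 / (k%:R + 1).

Definition mps_beta (k : nat) : R := 2 * L / k%:R.

(* The maximum with 1 only matters when M = 0: at least one inner step is
   needed for the average over inner iterates to make sense. *)
Definition mps_T (k : nat) : nat := maxn 1 `|Num.ceil (k%:R * M / L)|%N.

Definition mps_eta (k t : nat) : R :=
  mps_beta k * (t%:R - 1) + L * (mps_T k)%:R / k%:R.

End StepSizes.

(* Main.v *)
Require Import Defs.
From HB Require Import structures.
From mathcomp Require Import all_boot all_order all_algebra.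
From mathcomp Require Import all_classical all_reals all_analysis.
From mathcomp Require Import finmap mxtens.
From mathcomp Require Import ring lra.

Set Implicit Arguments.
Unset Strict Implicit.
Unset Printing Implicit Defensive.

Import Order.TTheory GRing.Theory Num.Theory.
Import numFieldNormedType.Exports.

Local Open Scope classical_set_scope.
Local Open Scope ring_scope.

(** Let FR be the penalised objective, xb and yb the two components of the output
    and, for (x, y) in the feasible set, FR xb y - FR x yb the penalised gap.
    The proof has two independent halves.

    The first half is the analysis of mirror-prox sliding.  An inner step is an
    extragradient step for the operator plus a frozen gradient of the penalty;
    [prox_optimality] makes the Bregman divergences of the inner iterates
    telescope ([inner_loop]), and an outer step is an accelerated gradient step
    for the quadratic penalty, whose curvature is at most L ([outer_step]).
    Weighting the outer steps by k (k + 1) gives [mps_rate]: the penalised gap is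
    at most delta + 6 L Omega^2 / (N (N + 1)).  Since L Omega^2 is twice eps times
    the square of A = D Omega sqrt chi / eps, any N >= 4 A brings it below
    2 eps, and N of order A costs the announced numbers of rounds and gradients.

    The second half is exact penalisation.  On consensus points the penalties
    vanish, so the penalised gap bounds the constrained gap.  For the violation
    of consensus, take the minimiser a of a convex function over consensus
    points.  There is a subgradient v at a that is nonnegative on consensus
    directions ([subdiff_optimality], by separation of convex sets; boundedness
    of the subdifferential, which is the finiteness of the penalty coefficient,
    rules out vertical hyperplanes).  Comparing a stacked vector with the one
    that repeats its row mean, which is feasible and at distance at most
    |W x| / sqrt lambda_min, shows that leaving consensus gains at most R |W x|
    ([exact_penalty]).  The penalised gap being at most 2 eps, this linear gain
    competes with R^2 |W x|^2 / eps, and |W x| <= 2 eps / R follows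
    ([quadratic_penalty_bound]).  The x half applies this to the partial maximum
    of FR over y, which is finite because a concave function is bounded above
    on a bounded convex set ([convex_bounded_below]); the y half applies it to
    - F xb. *)

(** * Inner products *)

Section InnerProduct.
Context {R : realType}.

Section Dotm.
Context {p q : nat}.
Implicit Types (a b c : 'M[R]_(p, q)) (s : R).

Lemma dotmC a b : dotm a b = dotm b a.
Proof. by apply: eq_bigr => i _; apply: eq_bigr => j _; rewrite mulrC. Qed.

Lemma dotmDl a b c : dotm (a + b) c = dotm a c + dotm b c.
Proof.
rewrite /dotm -big_split; apply: eq_bigr => i _ /=.
by rewrite -big_split; apply: eq_bigr => j _ /=; rewrite mxE mulrDl.
Qed.

Lemma dotmZl s a b : dotm (s *: a) b = s * dotm a b.
Proof.
rewrite /dotm mulr_sumr; apply: eq_bigr => i _.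
by rewrite mulr_sumr; apply: eq_bigr => j _; rewrite mxE mulrA.
Qed.

Lemma dotmNl a b : dotm (- a) b = - dotm a b.
Proof. by rewrite -scaleN1r dotmZl mulN1r. Qed.

Lemma dotmDr a b c : dotm a (b + c) = dotm a b + dotm a c.
Proof. by rewrite dotmC dotmDl !(dotmC a). Qed.

Lemma dotmZr s a b : dotm a (s *: b) = s * dotm a b.
Proof. by rewrite dotmC dotmZl dotmC. Qed.

Lemma dotmNr a b : dotm a (- b) = - dotm a b.
Proof. by rewrite dotmC dotmNl dotmC. Qed.

Lemma dotm0l a : dotm 0 a = 0.
Proof. by rewrite -(scale0r a) dotmZl mul0r. Qed.

Lemma dotm0r a : dotm a 0 = 0.
Proof. by rewrite dotmC dotm0l. Qed.

Lemma dotm_ge0 a : 0 <= dotm a a.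
Proof. by do 2!(apply: sumr_ge0 => ? _); rewrite -expr2 sqr_ge0. Qed.

Lemma dotm_eq0 a : (dotm a a == 0) = (a == 0).
Proof.
apply/eqP/eqP => [a0|->]; last exact: dotm0l.
apply/matrixP => i j; rewrite mxE; apply/eqP; rewrite -sqrf_eq0 expr2.
have /psumr_eq0P : forall i, true -> 0 <= \sum_j a i j * a i j.
  by move=> i' _; apply: sumr_ge0 => j' _; rewrite -expr2 sqr_ge0.
move=> /(_ a0 i isT) /psumr_eq0P-> // j' _.
by rewrite -expr2 sqr_ge0.
Qed.

Lemma sqr_norm2 a : norm2 a ^+ 2 = dotm a a.
Proof. exact/sqr_sqrtr/dotm_ge0. Qed.

Lemma norm2_ge0 a : 0 <= norm2 a.
Proof. exact: sqrtr_ge0. Qed.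

Lemma norm2_gt0 a : a != 0 -> 0 < norm2 a.
Proof. by move=> a0; rewrite sqrtr_gt0 lt_neqAle eq_sym dotm_eq0 a0 dotm_ge0. Qed.

Lemma norm2Z s a : norm2 (s *: a) = `|s| * norm2 a.
Proof.
by rewrite /norm2 dotmZl dotmZr mulrA -expr2 sqrtrM ?sqr_ge0// sqrtr_sqr.
Qed.

Lemma norm2N a : norm2 (- a) = norm2 a.
Proof. by rewrite -scaleN1r norm2Z normrN1 mul1r. Qed.

Lemma dotm_le_norm2 a b : dotm a b <= norm2 a * norm2 b.
Proof.
have [->|a0] := eqVneq a 0; first by rewrite dotm0l mulr_ge0 ?norm2_ge0.
have [->|b0] := eqVneq b 0; first by rewrite dotmC dotm0l mulr_ge0 ?norm2_ge0.
have := dotm_ge0 (norm2 b *: a - norm2 a *: b).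
rewrite !(dotmDl, dotmDr, dotmNl, dotmNr, dotmZl, dotmZr) -!sqr_norm2 (dotmC b a).
move=> h; have ab : 0 < norm2 a * norm2 b by rewrite mulr_gt0 ?norm2_gt0.
rewrite -(ler_pM2l ab); move: h; nra.
Qed.

End Dotm.

Lemma dotm_mulmxr p q r (x : 'M[R]_(p, q)) (A : 'M[R]_(q, r)) y :
  dotm (x *m A) y = dotm x (y *m A^T).
Proof.
rewrite /dotm; apply: eq_bigr => i _.
under eq_bigr do rewrite mxE mulr_suml.
rewrite exchange_big; apply: eq_bigr => j _ /=.
rewrite mxE mulr_sumr; apply: eq_bigr => k _.
by rewrite mxE -mulrA; congr (_ * _); rewrite mulrC.
Qed.

Section Dotz.
Context {p dx dy : nat}.
Implicit Types (z w u : 'M[R]_(p, dx) * 'M[R]_(p, dy)) (s : R).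

Lemma dotzC z w : dotz z w = dotz w z.
Proof. by rewrite /dotz !(dotmC z.1) !(dotmC z.2). Qed.

Lemma dotzDl z w u : dotz (z + w) u = dotz z u + dotz w u.
Proof. by rewrite /dotz !dotmDl addrACA. Qed.

Lemma dotzZl s z w : dotz (s *: z) w = s * dotz z w.
Proof. by rewrite /dotz !dotmZl mulrDr. Qed.

Lemma dotzNl z w : dotz (- z) w = - dotz z w.
Proof. by rewrite -scaleN1r dotzZl mulN1r. Qed.

Lemma dotzDr z w u : dotz u (z + w) = dotz u z + dotz u w.
Proof. by rewrite dotzC dotzDl !(dotzC u). Qed.

Lemma dotzZr s z w : dotz z (s *: w) = s * dotz z w.
Proof. by rewrite dotzC dotzZl dotzC. Qed.

Lemma dotzNr z w : dotz z (- w) = - dotz z w.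
Proof. by rewrite dotzC dotzNl dotzC. Qed.

Lemma dotz0r z : dotz z 0 = 0.
Proof. by rewrite /dotz !dotm0r addr0. Qed.

Lemma dotz_ge0 z : 0 <= dotz z z.
Proof. by rewrite addr_ge0 ?dotm_ge0. Qed.

Lemma dotz_eq0 z : (dotz z z == 0) = (z == 0).
Proof. by rewrite paddr_eq0 ?dotm_ge0// !dotm_eq0; case: z. Qed.

Lemma sqr_norm2z z : norm2z z ^+ 2 = dotz z z.
Proof. exact/sqr_sqrtr/dotz_ge0. Qed.

Lemma norm2z_ge0 z : 0 <= norm2z z.
Proof. exact: sqrtr_ge0. Qed.

Lemma norm2zZ s z : norm2z (s *: z) = `|s| * norm2z z.
Proof.
by rewrite /norm2z dotzZl dotzZr mulrA -expr2 sqrtrM ?sqr_ge0// sqrtr_sqr.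
Qed.

Lemma norm2zB z w : norm2z (z - w) = norm2z (w - z).
Proof. by rewrite -opprB -scaleN1r norm2zZ normrN1 mul1r. Qed.

Lemma norm2_le_norm2z z : norm2 z.2 <= norm2z z.
Proof. by rewrite ler_wsqrtr// lerDr dotm_ge0. Qed.

End Dotz.

(** Letting t tend to 0 isolates the first order term. *)
Lemma first_order_ge0 (b c : R) :
  (forall t, 0 < t <= 1 -> 0 <= b * t + c * t ^+ 2) -> 0 <= b.
Proof.
move=> h; rewrite leNgt; apply/negP => b0.
pose t := Num.min 1 (- b / (2 * (`|c| + 1))).
have c1 : 0 < `|c| + 1 by rewrite ltr_wpDl ?normr_ge0.
have t0 : 0 < t by rewrite lt_min ltr01 divr_gt0 ?mulr_gt0// oppr_gt0.
have t1 : t <= 1 by rewrite ge_min lexx.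
have tb : t * (2 * (`|c| + 1)) <= - b.
  by rewrite -ler_pdivlMr ?mulr_gt0// ge_min lexx orbT.
have := h t; rewrite t0 t1 => /(_ isT); apply/negP; rewrite -ltNge.
have := ler_norm c; nra.
Qed.

End InnerProduct.

(** * Convexity *)

Section Convexity.
Context {R : realType}.

Lemma convex_setE (E : lmodType R) (A : set E) : convex_set A <->
  forall x y t, 0 <= t <= 1 -> A x -> A y -> A (t *: x + (1 - t) *: y).
Proof.
split=> [cA x y t /andP[t0 t1] Ax Ay|cA x y t xA yA].
  exact: set_mem (cA x y (Itv01 t0 t1) (mem_set Ax) (mem_set Ay)).
have t01 : 0 <= t%:num <= 1 by apply/andP; split; [exact: ge0|exact: le1].
exact: (mem_set (cA x y _ t01 (set_mem xA) (set_mem yA))).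
Qed.

Lemma convex_functionE (E : lmodType R) (A : set E) (g : E -> R) :
  convex_function A g <->
  forall x y t, 0 <= t <= 1 -> A x -> A y ->
    g (t *: x + (1 - t) *: y) <= t * g x + (1 - t) * g y.
Proof.
split=> [cg x y t /andP[t0 t1] Ax Ay|cg t x y xA yA].
  exact: (cg (Itv01 t0 t1) x y (mem_set Ax) (mem_set Ay)).
have t01 : 0 <= t%:num <= 1 by apply/andP; split; [exact: ge0|exact: le1].
exact: (cg x y _ t01 (set_mem xA) (set_mem yA)).
Qed.

Lemma convex_set_sum (E : lmodType R) (A : set E) n (w : 'I_n -> R)
    (x : 'I_n -> E) :
  convex_set A -> (forall i, 0 <= w i) -> \sum_i w i = 1 ->
  (forall i, A (x i)) -> A (\sum_i w i *: x i).
Proof.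
move=> /convex_setE cA.
suff main k (v : 'I_k -> R) (y : 'I_k -> E) : (forall i, 0 <= v i) ->
    0 < \sum_i v i -> (forall i, A (y i)) ->
    A ((\sum_i v i)^-1 *: \sum_i v i *: y i).
  move=> w0 w1 Ax; have := main _ w x w0; rewrite w1 invr1 scale1r.
  exact.
elim: k v y => [|k IH] v y v0; first by rewrite big_ord0 ltxx.
rewrite !big_ord_recr /=; set S := \sum_(i < k) _; set v' := v ord_max.
move=> Sv Ay.
have S0 : 0 <= S by apply: sumr_ge0.
have [S00|S00] := eqVneq S 0.
  rewrite S00 add0r in Sv *.
  rewrite big1 ?add0r ?scalerA ?mulVf ?scale1r ?gt_eqF// => i _.
  have /psumr_eq0P -> // : forall i : 'I_k, true -> 0 <= v (widen_ord (leqnSn k) i).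
    by [].
  by rewrite scale0r.
have {S00}S0 : 0 < S by rewrite lt_neqAle eq_sym S00.
have v'0 : 0 <= v' by exact: v0.
have -> : (S + v')^-1 *: (\sum_(i < k) v (widen_ord (leqnSn k) i) *:
      y (widen_ord (leqnSn k) i) + v' *: y ord_max) =
    (S / (S + v')) *: (S^-1 *: \sum_(i < k) v (widen_ord (leqnSn k) i) *:
      y (widen_ord (leqnSn k) i)) + (1 - S / (S + v')) *: y ord_max.
  have [Sn Svn] : S != 0 /\ S + v' != 0 by rewrite !gt_eqF.
  by rewrite scalerDr !scalerA; congr (_ *: _ + _ *: _); field; rewrite ?Sn.
apply: cA => //; last exact: IH.
apply/andP; split; first by rewrite divr_ge0// ltW.
by rewrite ler_pdivrMr// mul1r lerDl.
Qed.

Lemma jensen (E : lmodType R) (A : set E) (g : E -> R) n (w : 'I_n -> R)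
    (x : 'I_n -> E) :
  convex_set A -> convex_function A g -> (forall i, 0 <= w i) ->
  \sum_i w i = 1 -> (forall i, A (x i)) ->
  g (\sum_i w i *: x i) <= \sum_i w i * g (x i).
Proof.
move=> /convex_setE cA /convex_functionE cg w0 w1 Ax.
pose epi := [set z : E * R^o | A z.1 /\ g z.1 <= z.2].
have cepi : convex_set epi.
  apply/convex_setE => -[a s] [b u] t t01 [/= Aa ga] [/= Ab gb].
  split=> /=; first exact: cA.
  apply: (le_trans (cg _ _ _ t01 Aa Ab)); move: t01 => /andP[t0 t1].
  by rewrite lerD// ler_wpM2l// subr_ge0.
have := convex_set_sum (x := fun i => (x i, g (x i) : R^o)) cepi w0 w1.
move=> /(_ (fun i => conj (Ax i) (lexx _))) [_].
by rewrite !raddf_sum.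
Qed.

End Convexity.

(** * Affine frames and lower bounds of convex functions *)

Section LowerBound.
Context {R : realType}.

Lemma le_mx_norm p q (x : 'M[R]_(p, q)) i j : `|x i j| <= `|x|.
Proof.
rewrite [leRHS]/Num.norm /= mx_normrE.
by apply/bigmax_geP; right => /=; exists (i, j).
Qed.

Lemma bounded_set_coord n (Y : set 'rV[R]_n) : bounded_set Y ->
  exists2 B : R, 0 < B & forall y, Y y -> forall i, `|y 0 i| <= B.
Proof.
move=> /ex_strict_bound_gt0[B B0 hB]; exists B => // y Yy i.
exact: le_trans (le_mx_norm _ _ _) (ltW (hB _ Yy)).
Qed.

(** Affine coordinates are linear coordinates of the vectors (1, y), so a
    family of points of Y whose lifted rank is maximal is an affine frame.  The
    coordinates are then a fixed linear function of y, hence bounded. *)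
Lemma bounded_affine_frame n (Y : set 'rV[R]_n) : bounded_set Y ->
  exists k (P : 'M[R]_(k, n)) (B : R), [/\ 0 < B, forall i, Y (row i P) &
    forall y, Y y -> exists w : 'I_k -> R,
      [/\ \sum_i w i = 1, forall i, `|w i| <= B & y = \sum_i w i *: row i P]].
Proof.
move=> /bounded_set_coord[B0 B0_gt0 hB0].
pose lft k (P : 'M[R]_(k, n)) : 'M[R]_(k, 1 + n) := row_mx (const_mx 1) P.
pose good r := `[< exists k (P : 'M[R]_(k, n)),
  (forall i, Y (row i P)) /\ \rank (lft k P) = r >].
have ex : exists r, good r.
  by exists (\rank (lft 0%N 0)); apply/asboolP; exists 0%N, 0; split=> // -[].
have ub r : good r -> (r <= 1 + n)%N.
  by move=> /asboolP[k [P [_ <-]]]; exact: rank_leq_col.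
have [r /asboolP[k [P [YP rP]]] rmax] := ex_maxnP ex ub.
have span y : Y y -> (lft _ y <= lft _ P)%MS.
  move=> Yy; have YPy i : Y (row i (col_mx P y)).
    case: (split_ordP i) => j ->; first by rewrite rowKu.
    by rewrite rowKd [j]ord1 row_id.
  have : good (\rank (lft _ (col_mx P y))).
    by apply/asboolP; exists (k + 1)%N, (col_mx P y).
  move=> /rmax; rewrite -rP.
  have -> : lft _ (col_mx P y) = col_mx (lft _ P) (lft _ y).
    by rewrite /lft -block_mxEv block_mxEh col_mx_const.
  rewrite -addsmxE => rle; apply: submx_trans (addsmxSr (lft _ P) _) _.
  by rewrite -(geq_leqif (mxrank_leqif_sup (addsmxSl _ _))).
pose c := pinvmx (lft _ P).
pose B := (1 + B0) * \sum_j \sum_i `|c j i| + 1.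
have S0 : 0 <= \sum_j \sum_i `|c j i| by do 2!apply: sumr_ge0 => ? _.
exists k, P, B; split=> //.
  by rewrite ltr_wpDl// mulr_ge0// addr_ge0// ltW.
move=> y Yy; exists (fun i => (lft _ y *m c) 0 i).
have lE := mulmxKpV (span y Yy); rewrite -/c in lE; split.
- have /(congr1 (fun M : 'rV_(1 + n) => M 0 (lshift n 0))) := lE.
  rewrite {2 3}/lft mul_mx_row !row_mxEl [RHS]mxE => <-; rewrite [RHS]mxE.
  by apply: eq_bigr => i _; rewrite [const_mx 1 _ _]mxE mulr1.
- move=> i; rewrite mxE; apply: (le_trans (ler_norm_sum _ _ _)).
  apply: (@le_trans _ _ ((1 + B0) * \sum_j \sum_i `|c j i|)); last first.
    by rewrite /B lerDl.
  rewrite mulr_sumr; apply: ler_sum => j _.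
  rewrite normrM ler_pM//; last by rewrite (bigD1 i)//= lerDl sumr_ge0.
  rewrite /lft; case: (split_ordP j) => l ->.
    by rewrite row_mxEl mxE normr1 lerDl ltW.
  by rewrite row_mxEr (le_trans (hB0 _ Yy _))// lerDr.
- rewrite -mulmx_sum_row.
  move: lE; rewrite /lft mul_mx_row => /(congr1 (@rsubmx _ _ _ _)).
  by rewrite !row_mxKr => ->.
Qed.

(** The centre of an affine frame is a convex combination of any given point y
    of Y, with a weight that does not depend on y, and of the frame, so that
    Jensen's inequality bounds the value at y from below. *)
Lemma convex_bounded_below n (A Y : set 'rV[R]_n) (g : 'rV[R]_n -> R) :
  convex_set A -> convex_function A g -> Y `<=` A -> bounded_set Y ->
  exists B, forall y, Y y -> B <= g y.
Proof.
move=> cA cg YA /bounded_affine_frame[k [P [B [B0 YP coord]]]].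
have [k0|k0] := posnP k.
  exists 0 => y /coord[w [+ _ _]]; move: P w YP {coord}; rewrite k0 => P w _.
  by rewrite big_ord0 => /eqP; rewrite eq_sym oner_eq0.
have kR : 0 < k%:R :> R by rewrite ltr0n.
pose mu := (k%:R * B)^-1; have mu0 : 0 < mu by rewrite invr_gt0 mulr_gt0.
pose gc := g (\sum_i k%:R^-1 *: row i P).
exists ((gc - 2 / k%:R * \sum_i `|g (row i P)|) / mu) => y Yy.
have [w [w1 wB yE]] := coord y Yy.
have muB : mu * B = k%:R^-1 by rewrite /mu; field; rewrite !gt_eqF.
pose om i := k%:R^-1 - mu * w i.
have om_ge0 i : 0 <= om i.
  rewrite subr_ge0 -muB ler_pM2l//.
  exact: le_trans (ler_norm _) (wB i).
have om_le i : om i <= 2 / k%:R.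
  rewrite mulr_natl mulr2n lerD2l -muB -mulrN ler_pM2l//.
  by rewrite (le_trans (ler_norm _))// normrN.
pose w' (i : 'I_k.+1) := if unlift ord0 i is Some j then om j else mu.
pose x' (i : 'I_k.+1) := if unlift ord0 i is Some j then row j P else y.
have sumE (E : lmodType R) (h : 'rV[R]_n -> E) : \sum_i w' i *: h (x' i) =
    mu *: h y + \sum_j om j *: h (row j P).
  rewrite big_ord_recl /w' /x' unlift_none; congr (_ + _).
  by apply: eq_bigr => j _; rewrite liftK.
have w'0 i : 0 <= w' i by rewrite /w'; case: unliftP => // _; exact: ltW.
have sum1 : \sum_i w' i = 1.
  transitivity (\sum_i w' i *: (1 : R^o)).
    by apply: eq_bigr => i _; rewrite /GRing.scale /= mulr1.
  rewrite (sumE R^o (fun=> 1)) /om /GRing.scale /=.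
  under eq_bigr do rewrite mulr1.
  rewrite sumrB -mulr_sumr w1 sumr_const card_ord -[_^-1 *+ _]mulr_natr.
  rewrite mulVf ?gt_eqF//.
  ring.
have Ax' i : A (x' i) by rewrite /x'; case: unliftP => [j _|_]; exact: YA.
have := jensen cA cg w'0 sum1 Ax'.
rewrite (sumE _ id) (sumE R^o g).
have -> : mu *: y + \sum_j om j *: row j P = \sum_i k%:R^-1 *: row i P.
  rewrite {1}yE scaler_sumr -big_split; apply: eq_bigr => i _ /=.
  by rewrite scalerA -scalerDl /om addrC subrK.
rewrite -/gc /GRing.scale /= => h.
rewrite ler_pdivrMr// lerBlDr (le_trans h)// mulrC lerD2l mulr_sumr.
apply: ler_sum => i _; apply: (@le_trans _ _ (om i * `|g (row i P)|)).
  by rewrite ler_wpM2l// ler_norm.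
by rewrite ler_wpM2r.
Qed.

End LowerBound.

(** * Separation from the origin *)

Section Separation.
Context {R : realType}.

Lemma continuous_sum (T : topologicalType) k (f : 'I_k -> T -> R) :
  (forall i, continuous (f i)) -> continuous (fun x => \sum_i f i x).
Proof.
elim: k f => [|k IH] f cf.
  have -> : (fun x => \sum_i f i x) = cst 0.
    by apply/funext => x; rewrite big_ord0.
  exact: cst_continuous.
have -> : (fun x => \sum_i f i x) =
    (fun x => \sum_(i < k) f (widen_ord (leqnSn k) i) x) \+ f ord_max.
  by apply/funext => x; rewrite big_ord_recr.
by move=> x; apply: continuousD; [exact: IH|exact: cf].
Qed.

Lemma continuous_dotm_mulmx n k (A B : 'M[R]_(n, k)) :
  continuous (fun x : 'rV[R]_n => dotm (x *m A) (x *m B)).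
Proof.
have cm (C : 'M[R]_(n, k)) i j : continuous (fun x : 'rV[R]_n => (x *m C) i j).
  have -> : (fun x : 'rV[R]_n => (x *m C) i j) =
      (fun x => \sum_l (fun y : 'rV[R]_n => y i l * C l j) x).
    by apply/funext => x; rewrite mxE.
  apply: continuous_sum => l x; apply: continuousM; first exact: coord_continuous.
  exact: cst_continuous.
rewrite /dotm; apply: continuous_sum => i.
by apply: continuous_sum => j x; apply: continuousM; exact: cm.
Qed.

Lemma continuous_dotm n (u : 'rV[R]_n) : continuous (fun x => dotm x u).
Proof.
rewrite /dotm; apply: continuous_sum => i.
apply: continuous_sum => j x; apply: continuousM; first exact: coord_continuous.
exact: cst_continuous.
Qed.

Lemma coord_bounded_set n (B : R) (K : set 'rV[R]_n) : 0 <= B ->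
  (forall x, K x -> forall i, `|x 0 i| <= B) -> bounded_set K.
Proof.
move=> B0 hB; exists B; split; first exact: num_real.
move=> M /ltW BM x Kx; apply: le_trans BM => /=.
rewrite /Num.norm /= mx_normrE; apply/bigmax_leP; split=> // -[i j] _ /=.
by rewrite [i]ord1; exact: hB.
Qed.

Lemma closed_ge0 n (f : 'rV[R]_n -> R) :
  continuous f -> closed [set x | 0 <= f x].
Proof.
move=> cf; apply: (@preimage_closed _ _ f [set r | 0 <= r]).
  by move=> x _; exact: cf.
exact: closed_ge.
Qed.

Lemma closed_eqr n (f : 'rV[R]_n -> R) c :
  continuous f -> closed [set x | f x = c].
Proof.
move=> cf; apply: (@preimage_closed _ _ f [set c]).
  by move=> x _; exact: cf.
exact: closed_eq.
Qed.

Lemma compact_unit_sphere n : compact [set x : 'rV[R]_n | dotm x x = 1].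
Proof.
apply: bounded_closed_compact; last first.
  apply: closed_eqr => x; have := @continuous_dotm_mulmx n n 1%:M 1%:M x.
  by under eq_fun do rewrite !mulmx1.
apply: (@coord_bounded_set _ 1) => // x /= x1 i.
rewrite -(expr_le1 (n := 2))// -x1 /dotm big_ord1 (bigD1 i)//= -expr2.
rewrite real_normK ?num_real//.
by rewrite lerDl sumr_ge0// => j _; rewrite -expr2 sqr_ge0.
Qed.

(** The point of least norm of a convex hull avoiding 0 makes a nonnegative
    inner product with every generator. *)
Lemma gordan n k (s : 'I_k -> 'rV[R]_n) : (0 < k)%N ->
  (forall w : 'I_k -> R, (forall i, 0 <= w i) -> \sum_i w i = 1 ->
     \sum_i w i *: s i != 0) ->
  exists2 u, u != 0 & forall i, 0 <= dotm u (s i).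
Proof.
move=> k0 s0.
pose S := \matrix_i s i.
have SE (w : 'rV[R]_k) : w *m S = \sum_i w 0 i *: s i.
  by rewrite mulmx_sum_row; apply: eq_bigr => i _; rewrite rowK.
pose D := [set w : 'rV[R]_k | (forall i, 0 <= w 0 i) /\ \sum_i w 0 i = 1].
have Dne : D !=set0.
  exists (delta_mx 0 (Ordinal k0)); split=> [i|].
    by rewrite mxE ler0n.
  rewrite (bigD1 (Ordinal k0))//= mxE !eqxx big1 ?addr0// => i /negPf i0.
  by rewrite mxE i0 andbF.
have Dcompact : compact D.
  apply: bounded_closed_compact.
    apply: (@coord_bounded_set _ 1) => // x [x0 x1] i.
    by rewrite ger0_norm// -x1 (bigD1 i)//= lerDl sumr_ge0.
  have -> : D = \bigcap_i [set w : 'rV[R]_k | 0 <= w 0 i]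
      `&` [set w | \sum_i w 0 i = 1].
    by apply/seteqP; split=> w [w0 w1]; split=> // i; [move=> _|]; exact: w0.
  apply: closedI.
    apply: closed_bigI => i _; apply: (@closed_ge0 _ (fun w : 'rV_k => w 0 i)).
    exact: coord_continuous.
  apply: closed_eqr; apply: (@continuous_sum _ _ (fun i (w : 'rV_k) => w 0 i)) => i.
  exact: coord_continuous.
have cN := @continuous_dotm_mulmx k n S S.
have [w /set_mem[w0 w1] wmin] := @compact_EVT_min _ _ _ D Dne Dcompact
  (continuous_subspaceT cN).
have u0 : w *m S != 0 by rewrite SE; exact: s0.
exists (w *m S) => // i.
have : 0 <= 2 * dotm (w *m S) (s i - w *m S).
  apply: (@first_order_ge0 _ _ (dotm (s i - w *m S) (s i - w *m S))) => t t01.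
  have /andP[t0 t1] := t01.
  have : (1 - t) *: w + t *: delta_mx 0 i \in D.
    apply/mem_set; split=> [j|].
      by rewrite !mxE addr_ge0// mulr_ge0// ?subr_ge0// ?ler0n// ltW.
    rewrite (eq_bigr (fun j => (1 - t) * w 0 j + t * (j == i)%:R)); last first.
      by move=> j _; rewrite !mxE eqxx.
    rewrite big_split /= -!mulr_sumr w1 (bigD1 i)//= eqxx big1.
      by rewrite addr0 !mulr1 subrK.
    by move=> j /negPf ->.
  move=> /wmin.
  have -> : ((1 - t) *: w + t *: delta_mx 0 i) *m S =
      w *m S + t *: (s i - w *m S).
    rewrite mulmxDl -!scalemxAl -rowE rowK scalerBl scale1r scalerBr.
    by rewrite addrAC addrA.
  move: (w *m S) (s i) => u v.
  rewrite !(dotmDl, dotmDr, dotmNl, dotmNr, dotmZl, dotmZr) (dotmC v u).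
  by lra.
rewrite dotmDr dotmNr pmulr_rge0// subr_ge0; apply: le_trans.
exact: dotm_ge0.
Qed.

(** Every finite part of S is handled by Gordan's lemma; compactness of the
    unit sphere yields one direction that works for all of S. *)
Lemma separation0 n (S : set 'rV[R]_n) : (0 < n)%N -> convex_set S -> ~ S 0 ->
  exists2 u, u != 0 & forall s, S s -> 0 <= dotm u s.
Proof.
case: n S => // n S _ cS S0.
pose K := [set x : 'rV[R]_n.+1 | dotm x x = 1].
have : compact K by exact: compact_unit_sphere.
rewrite compact_In0 => /(_ 'rV[R]_n.+1 S (fun s => K `&` [set u | 0 <= dotm u s])).
case.
- exists (fun s => [set u | 0 <= dotm u s]) => // s _.
  apply: (@closed_ge0 _ (fun u => dotm u s)); exact: continuous_dotm.
- move=> D DS; pose k := size (enum_fset D).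
  have nz v : v != 0 -> K ((norm2 v)^-1 *: v).
    move=> v0; rewrite /K /= dotmZl dotmZr -sqr_norm2.
    by have := norm2_gt0 v0 => ?; field; rewrite gt_eqF.
  have [k0|k0] := posnP k.
    exists ((norm2 (const_mx 1 : 'rV[R]_n.+1))^-1 *: const_mx 1) => s /=.
    by rewrite -[s \in D]/(s \in enum_fset D) (size0nil k0).
  pose s (i : 'I_k) := nth 0 (enum_fset D) i.
  have sS i : S (s i) by apply/set_mem/DS/mem_nth.
  have [w w0 w1|u u0 us] := @gordan _ k s k0.
    by apply/eqP => ws0; apply: S0; rewrite -ws0; exact: convex_set_sum.
  exists ((norm2 u)^-1 *: u) => v /= vD; split; first exact: nz.
  rewrite /= dotmZl mulr_ge0// ?invr_ge0 ?norm2_ge0//.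
  have vk : (index v (enum_fset D) < k)%N by rewrite index_mem.
  have := us (Ordinal vk); rewrite /s /= nth_index//.
move=> u hu.
have [[s Ss]|Sn] := pselect (S !=set0).
  exists u; last by move=> v /hu[].
  have [+ _] := hu _ Ss; rewrite /K /=; apply: contra_eqN => /eqP->.
  by rewrite dotm0l eq_sym oner_eq0.
exists (const_mx 1).
  by apply/eqP => /matrixP/(_ 0 0); rewrite !mxE => /eqP; rewrite oner_eq0.
by move=> s Ss; case: Sn; exists s.
Qed.

End Separation.

(** * Optimality over a convex set *)

Section Optimality.
Context {R : realType}.

Lemma dotm_mxvec p q (a b : 'M[R]_(p, q)) : dotm (mxvec a) (mxvec b) = dotm a b.
Proof.
rewrite /dotm big_ord1 (reindex _ (curry_mxvec_bij _ _)) /= pair_bigA /=.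
by apply: eq_bigr => -[i j] _ /=; rewrite !mxvecE.
Qed.

Lemma dotm_row_mx p q r (a c : 'M[R]_(p, q)) (b d : 'M[R]_(p, r)) :
  dotm (row_mx a b) (row_mx c d) = dotm a c + dotm b d.
Proof.
rewrite /dotm -big_split; apply: eq_bigr => i _; rewrite big_split_ord /=.
by congr (_ + _); apply: eq_bigr => j _; rewrite ?row_mxEl ?row_mxEr.
Qed.

Lemma dotm_scalar (s t : R) : dotm (scalar_mx s : 'M[R]_1) (scalar_mx t) = s * t.
Proof. by rewrite /dotm !big_ord1 !mxE eqxx !mulr1n. Qed.

(** Separating the strict epigraph of f over A from C x (-oo, f a] gives an
    affine function in between.  It is the graph of a subgradient unless the
    separating hyperplane is vertical; but a vertical hyperplane is a nonzero
    normal vector of A at a, whose multiples can be added to v0, so that the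
    subdifferential would be unbounded. *)
Lemma subdiff_optimality p q (A C : set 'M[R]_(p, q)) (f : 'M[R]_(p, q) -> R)
    (a v0 : 'M[R]_(p, q)) (B : R) :
  convex_set A -> convex_function A f -> convex_set C ->
  A a -> is_argmin C f a -> subdiff A f a v0 ->
  (forall v, subdiff A f a v -> norm2 v <= B) ->
  exists2 v, subdiff A f a v & forall c, C c -> 0 <= dotm v (c - a).
Proof.
move=> /convex_setE cA /convex_functionE cf /convex_setE cC Aa [Ca amin] v0f vB.
pose lft (x : 'M[R]_(p, q)) (t : R) : 'rV[R]_(p * q + 1) := row_mx (mxvec x) t%:M.
have lftD s x t r y z : lft (s *: x + r *: y) (s * t + r * z) =
    s *: lft x t + r *: lft y z.
  rewrite /lft !scale_row_mx add_row_mx linearD !linearZ; congr row_mx.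
  by apply/matrixP => i j; rewrite !ord1 !mxE eqxx !mulr1n.
pose S := [set s | exists x c t, [/\ A x, C c, f x - f a < t & s = lft (x - c) t]].
have [|||u u0 uS] := @separation0 R _ S.
- by rewrite addn1.
- apply/convex_setE => _ _ s s01 [x [c [t [Ax Cc xt ->]]]] [y [d [r [Ay Cd yr ->]]]].
  exists (s *: x + (1 - s) *: y), (s *: c + (1 - s) *: d), (s * t + (1 - s) * r).
  split; [exact: cA|exact: cC| |].
    have := cf _ _ _ s01 Ax Ay; move: (f _) => z; move: s01 => /andP[s0 s1] hz.
    have [s00|sn] := eqVneq s 0; first by rewrite s00 in hz *; lra.
    have {}s0 : 0 < s by rewrite lt_neqAle eq_sym sn.
    have : s * (f x - f a) < s * t by rewrite ltr_pM2l.
    have : (1 - s) * (f y - f a) <= (1 - s) * r by rewrite ler_wpM2l ?subr_ge0// ltW.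
    nra.
  rewrite -lftD; congr (lft _ _).
  by rewrite !scalerBr opprD addrACA.
- move=> [x [c [t [Ax Cc xt /eqP]]]]; rewrite /lft -[0]row_mx0 eq_sym => /eqP.
  move=> /eq_row_mx[]; rewrite -(linear0 mxvec) => /(can_inj mxvecK)/eqP.
  rewrite subr_eq0 => /eqP xc; move=> /matrixP/(_ 0 0); rewrite !mxE /= => t0.
  by move: (amin _ Cc) t0 xt; rewrite -xc mulr1n; lra.
pose w := vec_mx (lsubmx u); pose s := rsubmx u 0 0.
have uE : u = lft w s by rewrite /lft vec_mxK -mx11_scalar hsubmxK.
have key x c t : A x -> C c -> f x - f a < t -> 0 <= dotm w (x - c) + s * t.
  move=> Ax Cc xt; have /uS : S (lft (x - c) t) by exists x, c, t.
  by rewrite uE dotm_row_mx dotm_mxvec dotm_scalar.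
have s0 : 0 <= s.
  have := key a a 1 Aa Ca; rewrite !subrr dotmC dotm0l add0r mulr1.
  by apply.
have [sz|sn] := eqVneq s 0.
  exfalso.
  have wN x : A x -> 0 <= dotm w (x - a).
    move=> Ax; have := key x a (f x - f a + 1) Ax Ca; rewrite sz mul0r addr0.
    by rewrite ltrDl; exact.
  have w0 : w != 0.
    apply: contraNneq u0 => w0; rewrite uE w0 sz /lft linear0 -row_mx0.
    by apply/eqP; congr row_mx; apply/matrixP => i j; rewrite !mxE mul0rn.
  have vl (l : R) : 0 <= l -> l * norm2 w ^+ 2 <= dotm v0 w + B * norm2 w.
    move=> l0; have : subdiff A f a (v0 - l *: w).
      move=> b Ab; apply: le_trans (v0f b Ab).
      by rewrite dotmDl dotmNl dotmZl lerD2l gerBl mulr_ge0// wN.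
    move=> /vB vlB.
    have := dotm_le_norm2 (v0 - l *: w) (- w).
    rewrite norm2N dotmNr dotmDl dotmNl dotmZl -sqr_norm2.
    have := ler_wpM2r (norm2_ge0 w) vlB; lra.
  have W0 : 0 < norm2 w ^+ 2 by rewrite exprn_gt0// norm2_gt0.
  have l0 : 0 <= (`|dotm v0 w + B * norm2 w| + 1) / norm2 w ^+ 2.
    by rewrite divr_ge0 ?addr_ge0// ltW.
  have := vl _ l0; rewrite divfK ?gt_eqF//.
  by have := ler_norm (dotm v0 w + B * norm2 w); lra.
have {sn}s0 : 0 < s by rewrite lt_neqAle eq_sym sn.
have key' x c : A x -> C c -> 0 <= dotm w (x - c) + s * (f x - f a).
  move=> Ax Cc; apply/ler_addgt0Pr => e e0.
  have := key x c (f x - f a + e / s) Ax Cc; rewrite ltrDl divr_gt0// => /(_ isT).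
  by rewrite mulrDr mulrCA divff ?gt_eqF// mulr1 addrA.
have vE b : dotm (- s^-1 *: w) b = - (dotm w b / s).
  by rewrite dotmZl mulNr mulrC.
exists (- s^-1 *: w) => [x Ax|c Cc].
  rewrite vE -lerBrDl -(ler_pM2l s0) mulrN mulrCA divff ?gt_eqF// mulr1.
  by have := key' x a Ax Ca; lra.
rewrite vE oppr_ge0 pmulr_lle0 ?invr_gt0//.
have := key' a c Aa Cc; rewrite subrr mulr0 addr0 -opprB dotmNr; lra.
Qed.

End Optimality.

(** * Extreme eigenvalues *)

Section Rayleigh.
Context {R : realType}.

(** A minimiser of the quadratic form of A on the unit sphere of the orthogonal
    of an invariant set E is an eigenvector: the gradient A v - mu v is
    orthogonal to, and lies in, the orthogonal of E. *)
Lemma rayleigh_min n (A : 'M[R]_n) (E : set 'rV[R]_n) (x0 : 'rV[R]_n) :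
  A^T = A -> (forall u, E u -> E (u *m A)) -> x0 != 0 ->
  (forall u, E u -> dotm x0 u = 0) ->
  exists mu v, [/\ v != 0, forall u, E u -> dotm v u = 0, v *m A = mu *: v &
    forall x, (forall u, E u -> dotm x u = 0) ->
      mu * dotm x x <= dotm (x *m A) x].
Proof.
move=> symA EA x00 Ex0.
pose K := [set x | forall u, E u -> dotm x u = 0].
pose D := [set x : 'rV[R]_n | dotm x x = 1] `&` K.
have KZ s x : K x -> K (s *: x) by move=> Kx u Eu; rewrite dotmZl Kx// mulr0.
have KD x y : K x -> K y -> K (x + y).
  by move=> Kx Ky u Eu; rewrite dotmDl Kx// Ky// addr0.
have KA x : K x -> K (x *m A).
  by move=> Kx u Eu; rewrite dotm_mulmxr symA Kx//; exact: EA.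
have unit x : x != 0 -> dotm ((norm2 x)^-1 *: x) ((norm2 x)^-1 *: x) = 1.
  move=> xn0; rewrite dotmZl dotmZr -sqr_norm2.
  by have := norm2_gt0 xn0 => ?; field; rewrite gt_eqF.
have Dne : D !=set0.
  by exists ((norm2 x0)^-1 *: x0); split; [exact: unit|exact: KZ].
have cD : compact D.
  apply: compact_closedI; first exact: compact_unit_sphere.
  have -> : K = \bigcap_(u in E) [set x | dotm x u = 0].
    by apply/seteqP; split=> x Kx u Eu; exact: Kx.
  by apply: closed_bigI => u _; apply: closed_eqr; exact: continuous_dotm.
have cf := @continuous_dotm_mulmx R n n A 1%:M.
have [v /set_mem[v1 Kv] vmin] := @compact_EVT_min _ _ _ D Dne cD
  (continuous_subspaceT cf).
pose mu := dotm (v *m A) v.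
have minK x : K x -> mu * dotm x x <= dotm (x *m A) x.
  move=> Kx; have [->|xn0] := eqVneq x 0; first by rewrite mul0mx !dotm0l mulr0.
  have /vmin : (norm2 x)^-1 *: x \in D.
    by apply/mem_set; split; [exact: unit|exact: KZ].
  rewrite !mulmx1 -/mu -scalemxAl dotmZl dotmZr -sqr_norm2.
  have nx := norm2_gt0 xn0; have nx2 : 0 < norm2 x ^+ 2 by rewrite exprn_gt0.
  rewrite -(ler_pM2r nx2) => /le_trans; apply.
  by rewrite le_eqVlt; apply/orP; left; apply/eqP; field; rewrite gt_eqF.
have [g gE] : exists g, g = v *m A - mu *: v by eexists.
have Kg : K g by rewrite gE; apply: KD; [exact: KA|rewrite -scaleNr; exact: KZ].
exists mu, v; split=> //.
  by apply: contra_eqN v1 => /eqP ->; rewrite dotm0l eq_sym oner_eq0.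
apply/eqP; rewrite -subr_eq0 -gE -dotm_eq0 eq_le dotm_ge0 andbT -oppr_ge0.
have : 0 <= - (2 * dotm g g).
  apply: (@first_order_ge0 _ _ (dotm (g *m A) g - mu * dotm g g)) => t _.
  have := minK (v + (- t) *: g) (KD _ _ Kv (KZ _ _ Kg)).
  rewrite mulmxDl -scalemxAl !(dotmDl, dotmDr, dotmZl, dotmZr).
  have -> : dotm (g *m A) v = dotm (v *m A) g by rewrite dotm_mulmxr symA dotmC.
  have gg : dotm g g = dotm (v *m A) g - mu * dotm v g.
    by rewrite {1}gE dotmDl dotmNl dotmZl.
  rewrite -/mu (dotmC g v) v1; move: gg; nra.
lra.
Qed.

Section Symmetric.
Context {n : nat} (A : 'M[R]_n).
Hypotheses (symA : A^T = A) (psdA : forall x : 'rV[R]_n, 0 <= dotm (x *m A) x).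

Lemma eigenvalue_ge0 l : eigenvalue A l -> 0 <= l.
Proof.
move=> /eigenvalueP[v vA v0]; have := psdA v; rewrite vA dotmZl -sqr_norm2.
by rewrite pmulr_lge0// exprn_gt0// norm2_gt0.
Qed.

Lemma lambda_minp_ge0 : 0 <= lambda_minp A.
Proof.
rewrite /lambda_minp; set S := [set l | _].
have [S0|/set0P/negP/negPn/eqP->] := pselect (S !=set0); last by rewrite inf0.
by apply: lb_le_inf => // l [/ltW].
Qed.

Lemma lambda_minp_le (x : 'rV[R]_n) :
  (forall u : 'rV[R]_n, u *m A = 0 -> dotm x u = 0) ->
  lambda_minp A * dotm x x <= dotm (x *m A) x.
Proof.
move=> xk; have [->|x0] := eqVneq x 0; first by rewrite mul0mx !dotm0l mulr0.
have [|mu [v [v0 vk vA min]]] :=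
    @rayleigh_min n A [set u | u *m A = 0] x symA _ x0 xk.
  by move=> u /= ->; rewrite mul0mx.
apply: le_trans (min x xk); rewrite ler_wpM2r ?dotm_ge0//.
apply: ge_inf; first by exists 0 => l [/ltW].
have muE : eigenvalue A mu by apply/eigenvalueP; exists v.
split=> //; rewrite lt_neqAle eigenvalue_ge0// andbT eq_sym.
apply/eqP => mu0; move: v0; rewrite -dotm_eq0 vk ?eqxx//=.
by rewrite vA mu0 scale0r.
Qed.

Lemma lambda_max_ge (x : 'rV[R]_n) :
  dotm (x *m A) x <= lambda_max A * dotm x x.
Proof.
have [->|x0] := eqVneq x 0; first by rewrite mul0mx !dotm0l mulr0.
have symN : (- A)^T = - A.
  by rewrite -[in RHS]symA; apply/matrixP => i j; rewrite !mxE.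
have [//|//|mu [v [v0 _ vA min]]] := @rayleigh_min n (- A) set0 x symN _ x0 _.
have muE : eigenvalue A (- mu).
  apply/eigenvalueP; exists v => //.
  by rewrite scaleNr -vA mulmxN opprK.
have {}min (y : 'rV[R]_n) : dotm (y *m A) y <= - mu * dotm y y.
  have /min : forall u : 'rV[R]_n, set0 u -> dotm y u = 0 by [].
  by rewrite mulmxN dotmNl mulNr lerNr.
apply: (le_trans (min x)); rewrite ler_wpM2r ?dotm_ge0//.
apply: ub_le_sup => //; exists (- mu) => l /eigenvalueP[w wA w0].
have := min w; rewrite wA dotmZl ler_pM2r//.
by rewrite -sqr_norm2 exprn_gt0// norm2_gt0.
Qed.

Lemma lambda_max_ge0 : 0 <= lambda_max A.
Proof.
rewrite /lambda_max; set S := [set l | _].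
have [[l Sl]|/set0P/negP/negPn/eqP->] := pselect (S !=set0); last by rewrite sup0.
have [v vA v0] := eigenvalueP Sl.
have := lambda_max_ge v; rewrite -/S => /(le_trans (psdA v)).
by rewrite -/S pmulr_lge0// -sqr_norm2 exprn_gt0// norm2_gt0.
Qed.

End Symmetric.

Lemma dotm_trmx p q (a b : 'M[R]_(p, q)) : dotm a^T b^T = dotm a b.
Proof.
rewrite /dotm exchange_big; apply: eq_bigr => i _; apply: eq_bigr => j _.
by rewrite !mxE.
Qed.

Lemma dotm_mulmxl p q r (A : 'M[R]_(p, q)) (x : 'M[R]_(q, r)) y :
  dotm (A *m x) y = dotm x (A^T *m y).
Proof.
by rewrite -dotm_trmx trmx_mul dotm_mulmxr -[RHS]dotm_trmx trmx_mul.
Qed.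

Section Gram.
Context {n : nat} (W : 'M[R]_n).

Let gramE (x : 'rV[R]_n) : dotm (x *m (W^T *m W)) x = norm2 (W *m x^T) ^+ 2.
Proof. by rewrite mulmxA dotm_mulmxr sqr_norm2 -dotm_trmx trmx_mul trmxK. Qed.

Let gram_sym : (W^T *m W)^T = W^T *m W.
Proof. by rewrite trmx_mul trmxK. Qed.

Let gram_psd (x : 'rV[R]_n) : 0 <= dotm (x *m (W^T *m W)) x.
Proof. by rewrite gramE sqr_ge0. Qed.

Lemma gram_lambda_minp_ge0 : 0 <= lambda_minp (W^T *m W).
Proof. exact: lambda_minp_ge0. Qed.

Lemma gram_lambda_max_ge0 : 0 <= lambda_max (W^T *m W).
Proof. exact: lambda_max_ge0. Qed.

Lemma gram_lambda_max_ge (x : 'cV[R]_n) :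
  norm2 (W *m x) ^+ 2 <= lambda_max (W^T *m W) * dotm x x.
Proof.
have := lambda_max_ge gram_sym x^T; rewrite gramE trmxK.
by rewrite dotm_trmx.
Qed.

Lemma gram_lambda_minp_le (x : 'cV[R]_n) :
  (forall u : 'cV[R]_n, W *m u = 0 -> dotm x u = 0) ->
  lambda_minp (W^T *m W) * dotm x x <= norm2 (W *m x) ^+ 2.
Proof.
move=> xk; have := @lambda_minp_le _ _ gram_sym gram_psd x^T.
rewrite gramE trmxK dotm_trmx; apply => u uW.
rewrite -dotm_trmx trmxK xk//; apply/eqP; rewrite -dotm_eq0 -sqr_norm2 -gramE.
by rewrite uW dotm0l.
Qed.

End Gram.
End Rayleigh.

(** * Consensus and gossip matrices *)

Section Consensus.
Context {R : realType} {m q : nat}.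
Implicit Types x y : 'M[R]_(m, q).

Lemma convex_stacked (A : set 'rV[R]_q) :
  convex_set A -> convex_set (stacked A : set 'M[R]_(m, q)).
Proof.
move=> /convex_setE cA; apply/convex_setE => y z s s01 Ay Az i.
by rewrite linearD !linearZ /=; exact: cA.
Qed.

Lemma flatD x y : flat (x + y) = flat x + flat y.
Proof. by apply/matrixP => i j; rewrite !mxE. Qed.

Lemma flatZ s x : flat (s *: x) = s *: flat x.
Proof. by apply/matrixP => i j; rewrite !mxE. Qed.

Lemma sum_mxtens (G : 'I_(m * q) -> R) :
  \sum_k G k = \sum_i \sum_j G (mxtens_index (i, j)).
Proof.
rewrite pair_bigA /= (reindex (@mxtens_index m q)) /=; last first.
  by exists (@mxtens_unindex m q) => k _; rewrite ?mxtens_indexK ?mxtens_unindexK.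
by apply: eq_bigr => -[i j].
Qed.

Lemma dotm_flat x y : dotm (flat x) (flat y) = dotm x y.
Proof.
rewrite /dotm sum_mxtens; apply: eq_bigr => i _; apply: eq_bigr => j _.
by rewrite big_ord1 !mxE mxtens_indexK.
Qed.

Lemma flat_surj (u : 'cV[R]_(m * q)) : exists x, u = flat x.
Proof.
exists (\matrix_(i, j) u (mxtens_index (i, j)) 0).
apply/matrixP => k l; rewrite [l]ord1 !mxE.
by rewrite -[in LHS](mxtens_unindexK k); case: (mxtens_unindex k).
Qed.

Lemma flat_eq0 x : (flat x == 0) = (x == 0).
Proof. by rewrite -!dotm_eq0 dotm_flat. Qed.

Lemma tens1_flat (A : 'M[R]_m) x : (A *t 1%:M) *m flat x = flat (A *m x).
Proof.
apply/matrixP => k l; rewrite [l]ord1 !mxE.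
rewrite sum_mxtens; apply: eq_bigr => i _; rewrite (bigD1 (mxtens_unindex k).2)//= big1.
  by rewrite !mxE mxtens_indexK /= eqxx mulr1 addr0.
move=> j jk; rewrite !mxE mxtens_indexK /= eq_sym (negPf jk).
by rewrite mulr0 mul0r.
Qed.

Lemma mulWD (W : 'M[R]_(m * q)) x y : mulW W (x + y) = mulW W x + mulW W y.
Proof. by rewrite /mulW flatD mulmxDr. Qed.

Lemma mulWZ (W : 'M[R]_(m * q)) s x : mulW W (s *: x) = s *: mulW W x.
Proof. by rewrite /mulW flatZ scalemxAr. Qed.

Lemma mulWN (W : 'M[R]_(m * q)) x : mulW W (- x) = - mulW W x.
Proof. by rewrite -scaleN1r mulWZ scaleN1r. Qed.

(** The orthogonal projection onto the consensus space. *)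
Definition row_mean x : 'M[R]_(m, q) := \matrix_i (m%:R^-1 *: \sum_k row k x).

Section Gossip.
Context (e : rel 'I_m) (Wt : 'M[R]_m) (W : 'M[R]_(m * q)).
Hypotheses (gWt : gossip_matrix e Wt) (sW : is_psd_sqrt (Wt *t 1%:M) W).

Lemma mulW_eq0 x : mulW W x = 0 <-> Wt *m x = 0.
Proof.
have [[symW _] WW] := sW; split=> [Wx0|Wtx0].
  apply/eqP; rewrite -flat_eq0 -tens1_flat -WW -mulmxA.
  by move: Wx0; rewrite /mulW => ->; rewrite mulmx0.
apply/eqP; rewrite -dotm_eq0 dotm_mulmxl symW mulmxA WW tens1_flat Wtx0.
have -> : flat (0 : 'M[R]_(m, q)) = 0 by apply/eqP; rewrite flat_eq0.
by rewrite dotmC dotm0l.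
Qed.

Lemma gossip_kernel x : Wt *m x = 0 <-> exists c, x = \matrix_i c.
Proof.
have [_ _ ker] := gWt; split=> [Wx0|[c ->]].
  have colx j : exists c, col j x = const_mx c.
    by apply/ker; rewrite colE mulmxA Wx0 mul0mx.
  have [c cE] := choice colx; exists (\row_j c j).
  apply/matrixP => i j; rewrite !mxE.
  by have /colP/(_ i) := cE j; rewrite !mxE.
have -> : \matrix_(i < m) c = (const_mx 1 : 'cV_m) *m c.
  by apply/matrixP => i j; rewrite !mxE big_ord1 !mxE mul1r.
by rewrite mulmxA (iffRL (ker _)) ?mul0mx//; exists 1.
Qed.

Lemma mulW_row_mean x : mulW W (row_mean x) = 0.
Proof. by apply/mulW_eq0/gossip_kernel; eexists. Qed.

Lemma consensus_row_mean (X : set 'rV[R]_q) x :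
  convex_set X -> stacked X x -> consensus X W (row_mean x).
Proof.
move=> cX Xx; split; last exact: mulW_row_mean.
move=> i; rewrite rowK scaler_sumr; apply: convex_set_sum => //.
have m0 : (0 < m)%N by exact: leq_ltn_trans (ltn_ord i).
by rewrite sumr_const card_ord -[_^-1 *+ _]mulr_natr mulVf// pnatr_eq0 -lt0n.
Qed.

Lemma lambda_minp_row_mean x :
  lambda_minp (W^T *m W) * norm2 (x - row_mean x) ^+ 2 <= norm2 (mulW W x) ^+ 2.
Proof.
have -> : mulW W x = mulW W (x - row_mean x).
  by rewrite mulWD mulWN mulW_row_mean oppr0 addr0.
rewrite sqr_norm2 -dotm_flat; apply: gram_lambda_minp_le => _u.
have [u ->] := flat_surj _u; rewrite -/(mulW W u) dotm_flat.
move=> /mulW_eq0/gossip_kernel[c ->].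
rewrite /dotm exchange_big big1// => j _; under eq_bigr do rewrite !mxE.
rewrite -mulr_suml sumrB [X in _ - X](_ : _ = \sum_i x i j) ?subrr ?mul0r//.
have [m0|m0] := posnP m; last first.
  rewrite (eq_bigr (fun=> m%:R^-1 * \sum_i x i j)) => [|i _].
    by rewrite sumr_const card_ord -[_ *+ m]mulr_natl mulVKf// pnatr_eq0 -lt0n.
  by rewrite summxE; congr (_ * _); apply: eq_bigr => k _; rewrite mxE.
by rewrite !big1// => i _; have := ltn_ord i; rewrite [X in (_ < X)%N]m0.
Qed.

End Gossip.
End Consensus.


(** * Exactness of the distance to consensus as a penalty *)

Section Exactness.
Context {R : realType} {m q : nat}.

(** Compare x with its row mean c: a subgradient v at the constrained minimiser
    a that is nonnegative on the consensus directions loses at most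
    norm2 v * norm2 (x - c) on the way from c to x, and nothing from a to c.
    Because c stays in X, constraints on X cost nothing. *)
Lemma exact_penalty (e : rel 'I_m) (Wt : 'M[R]_m) (W : 'M[R]_(m * q))
    (X U : set 'rV[R]_q) (f : 'M[R]_(m, q) -> R) (a v0 : 'M[R]_(m, q)) (r : R) :
  gossip_matrix e Wt -> is_psd_sqrt (Wt *t 1%:M) W ->
  convex_set X -> X `<=` U -> convex_set U -> convex_function (stacked U) f ->
  is_argmin (consensus X W) f a -> 0 <= r ->
  subdiff (stacked U) f a v0 ->
  (forall v, subdiff (stacked U) f a v ->
     norm2 v ^+ 2 <= r ^+ 2 * lambda_minp (W^T *m W)) ->
  forall x, stacked X x -> f a <= f x + r * norm2 (mulW W x).
Proof.
move=> gW sW cX XU cU cf amin r0 v0f vr x Xx.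
have cUm := convex_stacked (m := m) cU.
have cC : convex_set (consensus X W).
  apply/convex_setE => y z s s01 [Xy Wy] [Xz Wz]; split.
    by move=> i; rewrite linearD !linearZ /=; move/convex_setE: cX; apply.
  by rewrite mulWD !mulWZ Wy Wz !scaler0 addr0.
have Ua : stacked U a by case: amin => -[Xa _] _ i; apply: XU.
have l0 := gram_lambda_minp_ge0 W.
have [|v vf vC] := @subdiff_optimality _ _ _ _ _ f a v0
    (Num.sqrt (r ^+ 2 * lambda_minp (W^T *m W))) cUm cf cC Ua amin v0f.
  move=> v /vr vle; rewrite -[norm2 v]ger0_norm ?norm2_ge0// -sqrtr_sqr.
  exact: ler_wsqrtr.
have hc := vC _ (consensus_row_mean gW sW cX Xx).
have := vf x (fun i => XU _ (Xx i)).
have -> : x - a = - (row_mean x - x) + (row_mean x - a).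
  by rewrite opprB addrA subrK.
rewrite dotmDr dotmNr => hx.
have := dotm_le_norm2 v (row_mean x - x).
suff : norm2 v * norm2 (row_mean x - x) <= r * norm2 (mulW W x) by lra.
have nC : norm2 (row_mean x - x) = norm2 (x - row_mean x).
  by rewrite -opprB norm2N.
rewrite nC -(@ler_pXn2r _ 2)// ?nnegrE ?mulr_ge0 ?norm2_ge0// !exprMn.
apply: (@le_trans _ _ (r ^+ 2 * lambda_minp (W^T *m W) *
    norm2 (x - row_mean x) ^+ 2)).
  by rewrite ler_wpM2r ?sqr_ge0//; exact: vr.
by rewrite -mulrA ler_wpM2l ?sqr_ge0// (lambda_minp_row_mean gW sW).
Qed.

End Exactness.

(** * Gradients along segments and Bregman divergences *)

Section Gradient.
Context {R : realType} {p dx dy : nat}.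
Notation vec := ('M[R]_(p, dx) * 'M[R]_(p, dy))%type.
Implicit Types (A : set vec) (g : vec -> R) (z w v : vec).

Lemma is_gradientN A g z v :
  is_gradient A g z v -> is_gradient A (fun x => - g x) z (- v).
Proof.
rewrite /is_gradient => /cvgN; rewrite oppr0.
apply: cvg_trans; apply: near_eq_cvg; near=> x.
by rewrite /= dotzNl -mulNr !opprD !opprK.
Unshelve. all: by end_near. Qed.

Lemma gradient_segment A g z v w (e : R) : is_gradient A g z v ->
  (forall t : R, 0 < t <= 1 -> A (z + t *: (w - z))) -> 0 < e ->
  exists2 t0, 0 < t0 & forall t, 0 < t <= 1 -> t <= t0 ->
    g (z + t *: (w - z)) - g z <= t * dotz v (w - z) + e * (t * norm2z (w - z)).
Proof.
move=> /cvgrPdist_lt gz Az e0.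
have [<-|wz] := eqVneq z w.
  exists 1 => // t _ _; rewrite subrr scaler0 addr0 subrr /norm2z.
  by rewrite !dotz0r sqrtr0 !mulr0 addr0.
have n0 : 0 < norm2z (w - z).
  rewrite sqrtr_gt0 lt_neqAle dotz_ge0 andbT eq_sym dotz_eq0 subr_eq0.
  by rewrite eq_sym.
have ct : (fun t : R => z + t *: (w - z)) @ (0 : R) --> z.
  rewrite -[X in _ --> X](addr0 z); apply: cvgD; first exact: cvg_cst.
  rewrite -[X in _ --> X](scale0r (w - z)); apply: cvgZr_tmp.
  exact: cvg_id.
have /ct[t0 /= t00 ht] := gz e e0.
exists (t0 / 2) => [|t /andP[t_gt0 t_le1] tt0]; first by rewrite divr_gt0.
have tw : `|t| * norm2z (w - z) = t * norm2z (w - z) by rewrite gtr0_norm.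
have : `|0 - (g (z + t *: (w - z)) - g z - dotz v (z + t *: (w - z) - z)) /
    norm2z (z + t *: (w - z) - z)| < e.
  apply: ht => /=.
  - by rewrite sub0r normrN gtr0_norm//; lra.
  - rewrite -subr_eq0 [z + _]addrC addrK scaler_eq0 subr_eq0 negb_or.
    by rewrite gt_eqF//= eq_sym.
  - by apply: Az; rewrite t_gt0.
rewrite sub0r normrN [z + _]addrC addrK norm2zZ dotzZr tw => /ltW.
rewrite ler_norml => /andP[_]; rewrite ler_pdivrMr ?mulr_gt0//.
lra.
Qed.

(** Divide by t and let t tend to 0.  Used for g and for - g, this bounds a
    directional derivative from both sides. *)
Lemma gradient_ge A g z v w (K C : R) : is_gradient A g z v ->
  (forall t : R, 0 < t <= 1 -> A (z + t *: (w - z))) ->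
  (forall t : R, 0 < t <= 1 -> K * t + C * t ^+ 2 <= g (z + t *: (w - z)) - g z) ->
  K <= dotz v (w - z).
Proof.
move=> gz Az hK; apply/ler_addgt0Pr => e e0.
have n0 := norm2z_ge0 (w - z).
pose e' := e / (2 * (norm2z (w - z) + 1)).
have e'0 : 0 < e' by rewrite divr_gt0// mulr_gt0// ltr_wpDl.
have e'n : e' * norm2z (w - z) <= e / 2.
  have -> : e / 2 = e' * (norm2z (w - z) + 1).
    by rewrite /e'; field; rewrite gt_eqF// ltr_wpDl.
  by rewrite ler_pM2l// lerDl.
have [t0 t00 ht] := gradient_segment gz Az e'0.
have c0 : 0 < 2 * (`|C| + 1) by rewrite mulr_gt0// ltr_wpDl.
pose t := Num.min (Num.min 1 t0) (e / (2 * (`|C| + 1))).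
have t_gt0 : 0 < t by rewrite !lt_min ltr01 t00 divr_gt0.
have tb : t * (2 * (`|C| + 1)) <= e by rewrite -ler_pdivlMr// ge_min lexx orbT.
have t1 : t <= 1 by rewrite !ge_min lexx.
have tt0 : t <= t0 by rewrite !ge_min lexx orbT.
have t01 : 0 < t <= 1 by rewrite t_gt0.
have := ht t t01 tt0; have := hK t t01; move: (g _ - g z) => G h1 h2.
rewrite -(ler_pM2r t_gt0).
have := ler_norm (- C); rewrite normrN => h3.
have h4 : - C * t * t <= `|C| * t * t by rewrite ler_pM2r// ler_pM2r.
have h5 : t * (2 * (`|C| + 1)) * t <= e * t by rewrite ler_pM2r.
have h6 : e' * norm2z (w - z) * t <= e / 2 * t by rewrite ler_pM2r.
have h7 : 0 < t * t by rewrite mulr_gt0.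
move: h1 h2 h4 h5 h6 h7; rewrite expr2; lra.
Qed.

End Gradient.

Section Bregman.
Context {R : realType} {dx dy : nat}.
Notation vec := ('rV[R]_dx * 'rV[R]_dy)%type.
Context (Z : set vec) (d : vec -> R) (gd : vec -> vec).
Hypotheses (cZ : convex_set Z)
  (dgd : forall z, Z z -> is_gradient Z d z (gd z))
  (dsc : strongly_convex1 Z d).
Local Notation V := (bregman d gd).

Let segment z w t : Z z -> Z w -> 0 < t <= 1 -> Z (z + t *: (w - z)).
Proof.
move=> Zz Zw /andP[t0 t1]; rewrite scalerBr addrCA -[z in z - _]scale1r -scalerBl.
by move/convex_setE: cZ; apply => //; rewrite ltW.
Qed.

Lemma bregman_ge z w : Z z -> Z w -> norm2z (z - w) ^+ 2 <= 2 * V z w.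
Proof.
move=> Zz Zw; pose n := norm2z (w - z) ^+ 2.
rewrite norm2zB -/n.
suff : - (d w - d z - 2^-1 * n) <= dotz (- gd z) (w - z).
  by rewrite dotzNl /bregman; lra.
apply: (@gradient_ge _ _ _ _ Z (fun x => - d x) z _ w _ (- (2^-1 * n))).
- exact/is_gradientN/dgd.
- by move=> t; exact: segment.
- move=> t t01; have /andP[t0 t1] := t01.
  have -> : z + t *: (w - z) = t *: w + (1 - t) *: z.
    by rewrite scalerBr addrCA -[z in z - _]scale1r -scalerBl.
  have := dsc Zw Zz (s := t); rewrite t1 ltW//= => /(_ isT); rewrite -/n.
  lra.
Qed.

Lemma bregman_ge0 z w : Z z -> Z w -> 0 <= V z w.
Proof.
move=> Zz Zw; have := bregman_ge Zz Zw; have := sqr_ge0 (norm2z (z - w)); lra.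
Qed.

(** First order optimality of a proximal step, rewritten with the three-point
    identity of the Bregman divergence. *)
Lemma prox_optimality (g a b u w : vec) (beta eta : R) : 0 <= beta -> 0 <= eta ->
  is_argmin Z (fun x => dotz g x + beta * V a x + eta * V b x) u -> Z w ->
  dotz g (u - w) <= beta * (V a w - V a u - V u w)
                    + eta * (V b w - V b u - V u w).
Proof.
move=> beta0 eta0 [Zu umin] Zw.
have key e : 0 < e -> 0 <= dotz (g - beta *: gd a - eta *: gd b) (w - u)
    + (beta + eta) * (dotz (gd u) (w - u) + e * norm2z (w - u)).
  move=> e0.
  have [t0 t00 ht] := gradient_segment (dgd Zu) (fun t => segment Zu Zw) e0.
  pose t := Num.min 1 t0; have t_gt0 : 0 < t by rewrite lt_min ltr01.
  have t01 : 0 < t <= 1 by rewrite t_gt0 ge_min lexx.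
  have tt0 : t <= t0 by rewrite ge_min lexx orbT.
  have := ht t t01 tt0; have := umin _ (segment Zu Zw t01).
  rewrite /bregman; move: (w - u) => s.
  rewrite !(dotzDl, dotzDr, dotzNl, dotzNr, dotzZl, dotzZr) => h1 h2.
  have h3 := ler_wpM2l (addr_ge0 beta0 eta0) h2.
  rewrite -(pmulr_rge0 _ t_gt0); move: h1 h3; lra.
have : 0 <= dotz (g - beta *: gd a - eta *: gd b) (w - u)
    + (beta + eta) * dotz (gd u) (w - u).
  apply/ler_addgt0Pr => e e0.
  have s0 : 0 < (beta + eta) * norm2z (w - u) + 1.
    by rewrite ltr_wpDl// mulr_ge0 ?addr_ge0// norm2z_ge0.
  have /key := divr_gt0 e0 s0; rewrite mulrDr addrA => /le_trans; apply.
  rewrite lerD2l mulrCA -mulrAC ler_pdivrMr// ler_pM2l//.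
  by rewrite lerDl.
rewrite /bregman !(dotzDl, dotzDr, dotzNl, dotzNr, dotzZl, dotzZr).
lra.
Qed.

End Bregman.

(** * Mirror-prox sliding *)

Section Node.
Context {R : realType} {m dx dy : nat}.
Notation stack := ('M[R]_(m, dx) * 'M[R]_(m, dy))%type.
Implicit Types z w : stack.

Lemma nodeD z w i : node (z + w) i = node z i + node w i.
Proof. by rewrite /node /= !linearD. Qed.

Lemma nodeN z i : node (- z) i = - node z i.
Proof. by rewrite /node /= !linearN. Qed.

Lemma dotz_node z w : dotz z w = \sum_i dotz (node z i) (node w i).
Proof.
rewrite /dotz /dotm -big_split; apply: eq_bigr => i _ /=.
by rewrite !big_ord1; congr (_ + _); apply: eq_bigr => j _; rewrite !mxE.
Qed.

Lemma node_operator (h : 'I_m -> _ -> _) z i :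
  node (operator h z) i = h i (node z i).
Proof. by rewrite /node /operator /= !rowK -surjective_pairing. Qed.

End Node.

Section Quadratic.
Context {R : realType} {m dx dy : nat}.
Notation stack := ('M[R]_(m, dx) * 'M[R]_(m, dy))%type.
Context (Wx : 'M[R]_(m * dx)) (Wy : 'M[R]_(m * dy)) (Ra Rb eps : R).
Hypothesis eps0 : 0 < eps.
Implicit Types z w v : stack.
Local Notation G := (penalty Wx Wy Ra Rb eps).

Lemma penalty_ge0 z : 0 <= G z.
Proof.
by apply: addr_ge0; (apply: mulr_ge0; [apply: divr_ge0|]; rewrite ?sqr_ge0// ltW).
Qed.

Definition penalty_form z w : R :=
  Ra ^+ 2 / eps * dotm (mulW Wx z.1) (mulW Wx w.1)
  + Rb ^+ 2 / eps * dotm (mulW Wy z.2) (mulW Wy w.2).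

Lemma penalty_add z w (s : R) :
  G (z + s *: w) = G z + 2 * s * penalty_form z w + s ^+ 2 * G w.
Proof.
rewrite /penalty /penalty_form !sqr_norm2 /= !mulWD !mulWZ.
rewrite !(dotmDl, dotmDr, dotmZl, dotmZr).
rewrite (dotmC (mulW Wx w.1) (mulW Wx z.1)) (dotmC (mulW Wy w.2) (mulW Wy z.2)).
by ring.
Qed.

(** [gradient_ge] from both sides identifies v with the differential of the
    quadratic form, whose Taylor expansion stops at the second order. *)
Lemma penalty_expansion z v w : is_gradient setT G z v ->
  G w = G z + dotz v (w - z) + G (w - z).
Proof.
move=> Gz; have wE : w = z + 1 *: (w - z) by rewrite scale1r addrC subrK.
rewrite [in LHS]wE penalty_add expr1n !mulr1 mul1r; congr (_ + _ + _).
apply/eqP; rewrite eq_le; apply/andP; split.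
  apply: (@gradient_ge _ _ _ _ setT G z v w _ (G (w - z))) => // t _.
  by rewrite penalty_add; lra.
rewrite -lerN2 -dotzNl.
apply: (@gradient_ge _ _ _ _ setT (fun x => - G x) z _ w _ (- G (w - z))) => //.
  exact: is_gradientN.
by move=> t _; rewrite penalty_add; lra.
Qed.

Lemma penalty_convex : convex_function setT G.
Proof.
apply/convex_functionE => z w s /andP[s0 s1] _ _.
have zE : z = w + 1 *: (z - w) by rewrite scale1r addrC subrK.
have -> : s *: z + (1 - s) *: w = w + s *: (z - w).
  by rewrite scalerBr scalerBl scale1r addrCA.
rewrite [in X in _ <= X]zE !penalty_add expr1n.
have s10 : 0 <= 1 - s by rewrite subr_ge0.
by have := mulr_ge0 (mulr_ge0 s0 s10) (penalty_ge0 (z - w)); lra.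
Qed.

End Quadratic.

Section Sliding.
Context {R : realType} {m dx dy : nat}.
Notation point := ('rV[R]_dx * 'rV[R]_dy)%type.
Notation stack := ('M[R]_(m, dx) * 'M[R]_(m, dy))%type.
Context (X : set 'rV[R]_dx) (Y : set 'rV[R]_dy).
Hypotheses (cX : convex_set X) (cY : convex_set Y).
Context (d : point -> R) (gd : point -> point).
Hypotheses (dgd : forall z, (X `*` Y) z -> is_gradient (X `*` Y) d z (gd z))
  (dsc : strongly_convex1 (X `*` Y) d).
Local Notation Zm := (stacked X `*` stacked Y : set stack).
Local Notation V := (bregman d gd).
Local Notation VS := (bregman_sum d gd).

Context (F : 'M[R]_(m, dx) -> 'M[R]_(m, dy) -> R) (h : 'I_m -> point -> point).
Hypotheses
  (Fx : forall y, stacked Y y -> convex_function (stacked X) (fun x => F x y))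
  (Fy : forall x, stacked X x -> convex_function (stacked Y) (fun y => - F x y))
  (Fh : forall z, Zm z -> saddle_subdiff X Y F z.1 z.2 (operator h z)).

Context (M delta : R).
Hypotheses (M0 : 0 <= M)
  (hH : forall z1 z2 z3, Zm z1 -> Zm z2 -> Zm z3 ->
     dotz (operator h z1 - operator h z2) (z1 - z3) <=
       M / 2 * norm2z (z1 - z2) ^+ 2 + M / 2 * norm2z (z1 - z3) ^+ 2 + delta).

Let cZ : convex_set (X `*` Y).
Proof.
apply/convex_setE => z w s s01 [Xz Yz] [Xw Yw]; split.
  by move/convex_setE: cX; exact.
by move/convex_setE: cY; exact.
Qed.

Let cZm : convex_set Zm.
Proof.
apply/convex_setE => z w s s01 [Xz Yz] [Xw Yw]; split.
  by move/convex_setE: (convex_stacked (m := m) cX); exact.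
by move/convex_setE: (convex_stacked (m := m) cY); exact.
Qed.

Let mem_Zm (z : stack) : (forall i, (X `*` Y) (node z i)) -> Zm z.
Proof. by move=> Zz; split=> i; case: (Zz i). Qed.

Let node_mem (z : stack) i : Zm z -> (X `*` Y) (node z i).
Proof. by case=> Xz Yz; split; [exact: Xz|exact: Yz]. Qed.

Lemma bregman_sum_ge z w : Zm z -> Zm w -> norm2z (z - w) ^+ 2 <= 2 * VS z w.
Proof.
move=> Zz Zw; rewrite sqr_norm2z dotz_node mulr_sumr.
apply: ler_sum => i _; rewrite nodeD nodeN -sqr_norm2z.
by apply: (bregman_ge cZ dgd dsc); exact: node_mem.
Qed.

Lemma bregman_sum_ge0 z w : Zm z -> Zm w -> 0 <= VS z w.
Proof.
move=> Zz Zw; apply: sumr_ge0 => i _.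
by apply: (bregman_ge0 cZ dgd dsc); exact: node_mem.
Qed.

Lemma prox_stack (g a b u w : stack) (beta eta : R) : 0 <= beta -> 0 <= eta ->
  (forall i, is_argmin (X `*` Y) (fun x => dotz (node g i) x
     + beta * V (node a i) x + eta * V (node b i) x) (node u i)) -> Zm w ->
  dotz g (u - w) <= beta * (VS a w - VS a u - VS u w)
                    + eta * (VS b w - VS b u - VS u w).
Proof.
move=> beta0 eta0 umin Zw.
rewrite dotz_node /bregman_sum -!sumrB !mulr_sumr -big_split.
apply: ler_sum => i _ /=; rewrite nodeD nodeN.
by apply: (prox_optimality cZ dgd) => //; exact: node_mem.
Qed.

(** The two half steps telescope through the middle point; the error made by
    evaluating the operator at b instead of zt is absorbed by the two Bregman
    terms with coefficient eta >= M. *)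
Lemma extragradient_step (g a b zt z1 w : stack) (beta eta : R) :
  0 <= beta -> M <= eta -> Zm b -> Zm w ->
  (forall i, is_argmin (X `*` Y) (fun x => dotz (node g i + h i (node b i)) x
     + beta * V (node a i) x + eta * V (node b i) x) (node zt i)) ->
  (forall i, is_argmin (X `*` Y) (fun x => dotz (node g i + h i (node zt i)) x
     + beta * V (node a i) x + eta * V (node b i) x) (node z1 i)) ->
  dotz (g + operator h zt) (zt - w) <=
    beta * VS a w - beta * VS a zt + eta * VS b w - (beta + eta) * VS z1 w + delta.
Proof.
move=> beta0 Meta Zb Zw ztmin z1min.
have Zzt : Zm zt by apply: mem_Zm => i; case: (ztmin i).
have Zz1 : Zm z1 by apply: mem_Zm => i; case: (z1min i).
have eta0 : 0 <= eta by exact: le_trans Meta.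
have p1 : dotz (g + operator h b) (zt - z1) <= beta * (VS a z1 - VS a zt - VS zt z1)
    + eta * (VS b z1 - VS b zt - VS zt z1).
  apply: prox_stack => // i; have := ztmin i.
  by rewrite nodeD node_operator.
have p2 : dotz (g + operator h zt) (z1 - w) <= beta * (VS a w - VS a z1 - VS z1 w)
    + eta * (VS b w - VS b z1 - VS z1 w).
  apply: prox_stack => // i; have := z1min i.
  by rewrite nodeD node_operator.
have := hH Zzt Zb Zz1.
have := bregman_sum_ge Zb Zzt; have := bregman_sum_ge Zzt Zz1.
rewrite (norm2zB b) => n1 n2.
have := ler_wpM2l M0 n1; have := ler_wpM2l M0 n2.
have : M * VS b zt <= eta * VS b zt by rewrite ler_wpM2r ?bregman_sum_ge0.
have : M * VS zt z1 <= eta * VS zt z1 by rewrite ler_wpM2r ?bregman_sum_ge0.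
have : 0 <= beta * VS zt z1 by rewrite mulr_ge0 ?bregman_sum_ge0.
move: p1 p2; rewrite !(dotzDl, dotzDr, dotzNl, dotzNr).
lra.
Qed.

Definition gap (z w : stack) : R := F z.1 w.2 - F w.1 z.2.

Lemma gap_le z w : Zm z -> Zm w -> gap z w <= dotz (operator h z) (z - w).
Proof.
move=> Zz [Xw Yw]; have [hx hy] := Fh Zz.
have := hx _ Xw; have := hy _ Yw; rewrite /gap /dotz /=.
rewrite !(dotmDr, dotmNr); lra.
Qed.

Lemma gap_convex w : Zm w -> convex_function Zm (fun z => gap z w).
Proof.
move=> [Xw Yw]; apply/convex_functionE => z1 z2 s s01 [X1 Y1] [X2 Y2].
have /convex_functionE/(_ z1.1 z2.1 s s01 X1 X2) := Fx Yw.
have /convex_functionE/(_ z1.2 z2.2 s s01 Y1 Y2) := Fy Xw.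
rewrite /gap /=; lra.
Qed.

Context (G : stack -> R) (L : R).
Hypotheses (L0 : 0 < L) (G0 : forall z, 0 <= G z)
  (GL : forall z, G z <= L / 2 * norm2z z ^+ 2)
  (Gexp : forall z v w, is_gradient setT G z v ->
     G w = G z + dotz v (w - z) + G (w - z))
  (GZ : forall s z, G (s *: z) = s ^+ 2 * G z)
  (cG : convex_function setT G).

Context (z0 : stack) (N : nat) (zu z zt zb gG : nat -> stack)
  (zin ztin : nat -> nat -> stack).
Hypotheses (Zz0 : Zm z0)
  (run : mps_run (X `*` Y) V h G (mps_T L M) (mps_beta L) mps_gamma
    (mps_eta L M) z0 N zu z zt zb gG zin ztin).
Local Notation T := (mps_T L M).

Let T_gt0 k : (0 < T k)%N.
Proof. by rewrite leq_max. Qed.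

Lemma mps_eta_ge k t : (0 < k)%N -> (0 < t)%N -> M <= mps_eta L M k t.
Proof.
move=> k0 t0; have kR : 0 < k%:R :> R by rewrite ltr0n.
have : M <= L * (T k)%:R / k%:R.
  rewrite ler_pdivlMr// -ler_pdivrMl//.
  apply: (@le_trans _ _ (Num.ceil (k%:R * M / L))%:~R).
    by rewrite mulrC [M * _]mulrC ceil_ge.
  apply: (@le_trans _ _ (`|Num.ceil (k%:R * M / L)|%N)%:R).
    by rewrite natr_absz ler_int ler_norm.
  by rewrite ler_nat leq_maxr.
move=> /le_trans; apply; rewrite /mps_eta lerDr mulr_ge0//.
  by rewrite divr_ge0 ?mulr_ge0// ltW.
by rewrite subr_ge0 ler1n.
Qed.

Lemma zin_mem k t : (0 < k <= N)%N -> (t <= T k)%N -> Zm (z k.-1) -> Zm (zin k t).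
Proof.
move=> kN; case: t => [|t] tT Zz; first by rewrite (mps_zin0 run).
by apply: mem_Zm => i; have [] := mps_zin run (t := t.+1) i kN tT.
Qed.

Lemma ztin_mem k t : (0 < k <= N)%N -> (0 < t <= T k)%N -> Zm (ztin k t).
Proof. by move=> kN tT; apply: mem_Zm => i; have [] := mps_ztin run i kN tT. Qed.

Lemma z_mem k : (k <= N)%N -> Zm (z k).
Proof.
elim: k => [|k IH] kN; first by rewrite (mps_z0 run).
by rewrite (mps_z run)//; apply: zin_mem => //; exact/IH/ltnW.
Qed.

(** [eta] grows by [beta] at each inner step, so the Bregman terms of the inner
    iterates telescope. *)
Lemma inner_loop k n w : (0 < k <= N)%N -> (n <= T k)%N -> Zm w ->
  \sum_(i < n) dotz (gG k + operator h (ztin k i.+1)) (ztin k i.+1 - w) <=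
    n%:R * mps_beta L k * VS (z k.-1) w
    - mps_beta L k * (\sum_(i < n) VS (z k.-1) (ztin k i.+1))
    + L * (T k)%:R / k%:R * VS (z k.-1) w
    - (L * (T k)%:R / k%:R + n%:R * mps_beta L k) * VS (zin k n) w + n%:R * delta.
Proof.
move=> kN + Zw; have /andP[k0 kN'] := kN.
have Za : Zm (z k.-1) by apply: z_mem; exact: leq_trans (leq_pred _) kN'.
elim: n => [|n IH] nT.
  by rewrite !big_ord0 (mps_zin0 run)// !mul0r !mulr0; lra.
have nT' : (0 < n.+1 <= T k)%N by [].
have := extragradient_step _ (mps_eta_ge k0 (ltn0Sn n)) (zin_mem kN (ltnW nT) Za)
  Zw (fun i => mps_ztin run i kN nT') (fun i => mps_zin run i kN nT').
have b0 : 0 <= mps_beta L k by rewrite divr_ge0// mulr_ge0// ltW.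
move=> /(_ b0); have := IH (ltnW nT).
rewrite !big_ord_recr /= /mps_eta -[n.+1%:R]natr1; set S1 := \sum_(i < n) _.
set S2 := \sum_(i < n) _; lra.
Qed.

Lemma zt_sum k : (0 < k <= N)%N ->
  zt k = \sum_(i < T k) (T k)%:R^-1 *: ztin k i.+1.
Proof. by move=> kN; rewrite (mps_zt run)// big_add1 big_mkord scaler_sumr. Qed.

Let weight k : \sum_(i < T k) (T k)%:R^-1 = 1 :> R.
Proof.
by rewrite sumr_const card_ord -[_ *+ _]mulr_natl divff// pnatr_eq0 -lt0n.
Qed.

Lemma zt_mem k : (0 < k <= N)%N -> Zm (zt k).
Proof.
move=> kN; rewrite zt_sum//; apply: (@convex_set_sum _ _ Zm) => [|i||i].
- exact: cZm.
- by rewrite invr_ge0 ler0n.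
- exact: weight.
- by apply: ztin_mem; rewrite /= ?ltn_ord.
Qed.

Let gamma01 k : (0 < k)%N -> 0 <= (mps_gamma k : R) <= 1.
Proof.
move=> k0; have k1 : 1 <= k%:R :> R by rewrite ler1n.
by rewrite /mps_gamma divr_ge0 ?addr_ge0//= ler_pdivrMr; lra.
Qed.

Lemma zb_mem k : (k <= N)%N -> Zm (zb k).
Proof.
elim: k => [|k IH] kN; first by rewrite (mps_zb0 run).
rewrite (mps_zb run)// addrC.
have /andP[g0 g1] := gamma01 (ltn0Sn k).
move/convex_setE: cZm; apply; last exact/IH/ltnW.
  by rewrite g0.
exact: zt_mem.
Qed.

(** The remainder of the expansion of G costs at most gamma L times the Bregman
    divergence from the prox centre; the inner loop subtracts beta times this
    divergence, and gamma L <= beta. *)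
Lemma outer_step k w : (0 < k <= N)%N -> Zm w ->
  gap (zb k) w + G (zb k) - G w <=
    (1 - mps_gamma k) * (gap (zb k.-1) w + G (zb k.-1) - G w)
    + mps_gamma k * (3 * L / k%:R * (VS (z k.-1) w - VS (z k) w) + delta).
Proof.
move=> kN Zw; have /andP[k0 kN'] := kN.
set ga := mps_gamma k; set a := z k.-1; set g := gG k; set Ti := (T k)%:R^-1 : R.
have kR : 0 < k%:R :> R by rewrite ltr0n.
have TR : 0 < (T k)%:R :> R by rewrite ltr0n.
have Ti0 : 0 <= Ti by rewrite invr_ge0 ltW.
have /andP[ga0 ga1] : 0 <= ga <= 1 := gamma01 k0.
have Zb : Zm (zb k.-1) by apply: zb_mem; exact: leq_trans (leq_pred _) kN'.
have Za : Zm a by apply: z_mem; exact: leq_trans (leq_pred _) kN'.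
have Zt := zt_mem kN; have gGk := mps_gG run kN; rewrite -/g in gGk.
have zbE := mps_zb run kN; have zuE := mps_zu run kN; rewrite -/ga in zbE zuE.
have Zt' (i : 'I_(T k)) : Zm (ztin k i.+1).
  by apply: ztin_mem; rewrite /= ?ltn_ord.
(* Jensen's inequality moves the three terms that depend on zt k to the inner
   iterates. *)
have gap_avg : gap (zt k) w <= \sum_(i < T k) Ti * gap (ztin k i.+1) w.
  by rewrite zt_sum//; exact: (jensen cZm (gap_convex Zw)).
have lin_avg : dotz g (zt k - w) = \sum_(i < T k) Ti * dotz g (ztin k i.+1 - w).
  transitivity (dotz g (\sum_(i < T k) Ti *: (ztin k i.+1 - w))).
    congr dotz; under eq_bigr do rewrite scalerBr.
    by rewrite sumrB -zt_sum// -scaler_suml weight scale1r.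
  elim/big_rec2: _ => [|i x y _ <-]; first by rewrite dotz0r.
  by rewrite [LHS]dotzDr dotzZr.
have G_avg : G (zt k - a) <= \sum_(i < T k) Ti * (L * VS a (ztin k i.+1)).
  have -> : zt k - a = \sum_(i < T k) Ti *: (ztin k i.+1 - a).
    under eq_bigr do rewrite scalerBr.
    by rewrite sumrB -zt_sum// -scaler_suml weight scale1r.
  apply: (@le_trans _ _ (\sum_(i < T k) Ti * G (ztin k i.+1 - a))).
    by apply: (@jensen _ _ setT) => //; exact: weight.
  apply: ler_sum => i _; rewrite ler_wpM2l// (le_trans (GL _))//.
  have := bregman_sum_ge Za (Zt' i).
  by rewrite norm2zB -(ler_pM2l L0); lra.
have inner := inner_loop kN (leqnn _) Zw.
rewrite -(mps_z run)// -/a -/g in inner.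
have gab : ga * L <= mps_beta L k.
  rewrite /ga /mps_gamma /mps_beta mulrAC ler_pM2l ?mulr_gt0//.
  by rewrite lef_pV2 ?posrE ?addr_gt0// lerDl.
have S0 : 0 <= \sum_(i < T k) VS a (ztin k i.+1).
  by apply: sumr_ge0 => i _; exact: bregman_sum_ge0.
have avg : gap (zt k) w + dotz g (zt k - w) + ga * G (zt k - a) <=
    3 * L / k%:R * (VS a w - VS (z k) w) + delta.
  have h1 : gap (zt k) w + dotz g (zt k - w) <= Ti * \sum_(i < T k)
      dotz (g + operator h (ztin k i.+1)) (ztin k i.+1 - w).
    rewrite mulr_sumr lin_avg; apply: (le_trans (lerD gap_avg (lexx _))).
    rewrite -big_split; apply: ler_sum => i _ /=.
    rewrite dotzDl -mulrDr addrC ler_wpM2l// lerD2l.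
    exact: gap_le.
  have h2 := ler_wpM2l Ti0 inner.
  have h3 := ler_wpM2l ga0 G_avg.
  have h4 : ga * \sum_(i < T k) Ti * (L * VS a (ztin k i.+1)) <=
      Ti * (mps_beta L k * \sum_(i < T k) VS a (ztin k i.+1)).
    rewrite -mulr_sumr -mulr_sumr mulrCA ler_wpM2l// mulrA.
    by rewrite ler_wpM2r.
  apply: (le_trans (lerD (le_trans h1 h2) (le_trans h3 h4))).
  rewrite le_eqVlt; apply/orP; left; apply/eqP; rewrite /Ti /mps_beta; field.
  by rewrite !gt_eqF.
(* zu k differs from zb k in its last term only, hence the factor ga ^+ 2 in
   front of the remainder of the expansion of G at zu k. *)
have zbu : zb k - zu k = ga *: (zt k - a).
  by rewrite zbE zuE opprD addrACA subrr add0r scalerBr.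
have e1 := Gexp (zb k) gGk; have e2 := Gexp w gGk; have e3 := Gexp (zb k.-1) gGk.
have := G0 (w - zu k); have := G0 (zb k.-1 - zu k).
rewrite zbu GZ in e1.
have gapc : gap (zb k) w <= ga * gap (zt k) w + (1 - ga) * gap (zb k.-1) w.
  rewrite zbE addrC; have /convex_functionE := gap_convex Zw; apply=> //.
  by rewrite ga0.
have := ler_wpM2l ga0 avg.
have zus : zu k = (1 - ga) *: zb k.-1 + ga *: a by [].
have : dotz g (zu k) = (1 - ga) * dotz g (zb k.-1) + ga * dotz g a.
  by rewrite zus dotzDr !dotzZr.
move: e1 e2 e3 gapc; rewrite !(dotzDr, dotzNr, dotzZr).
move=> e1 e2 e3 gapc duE av p1 p2.
have := mulr_ge0 ga0 p2; have : 0 <= 1 - ga by rewrite subr_ge0.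
move=> /mulr_ge0/(_ p1) q1 q2.
rewrite e1; move: q1 q2 av; rewrite e2 e3 duE.
lra.
Qed.

Lemma mps_rate w : Zm w ->
  N%:R * (N%:R + 1) * (gap (zb N) w + G (zb N) - G w) <=
    6 * L * VS z0 w + N%:R * (N%:R + 1) * delta.
Proof.
move=> Zw; pose Q k := gap (zb k) w + G (zb k) - G w.
(* The weight k (k + 1) telescopes since 1 - gamma_k = (k - 1) / (k + 1). *)
suff main k : (k <= N)%N -> k%:R * (k%:R + 1) * Q k <=
    6 * L * (VS z0 w - VS (z k) w) + k%:R * (k%:R + 1) * delta.
  apply: (le_trans (main N (leqnn _))); rewrite lerD2r ler_pM2l ?mulr_gt0//.
  by rewrite gerBl bregman_sum_ge0//; exact: z_mem.
elim: k => [|k IH] kN; first by rewrite (mps_z0 run) !mul0r subrr mulr0 addr0.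
have k0 : 0 <= k%:R :> R by [].
have k1 : 0 < (k%:R + 1) * (k%:R + 2) :> R by rewrite mulr_gt0// ltr_wpDl.
have h1 := IH (ltnW kN); have := @outer_step k.+1 w kN Zw; rewrite -!/(Q _) /=.
have kS : k.+1%:R = k%:R + 1 :> R by rewrite -natr1.
rewrite -(ler_pM2l k1) /mps_gamma kS => h2.
set W := VS (z k) w in h1 h2; set W' := VS (z k.+1) w in h2 *.
have e : (k%:R + 1) * (k%:R + 2) * ((1 - 2 / (k%:R + 1 + 1)) * Q k +
    2 / (k%:R + 1 + 1) * (3 * L / (k%:R + 1) * (W - W') + delta)) =
  k%:R * (k%:R + 1) * Q k + 6 * L * (W - W') + 2 * (k%:R + 1) * delta.
  by field; rewrite !gt_eqF//; lra.
rewrite e in h2; move: h1 h2; lra.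
Qed.

End Sliding.

(** * Suprema of subgradient norms *)

Section Suprema.
Context {R : realType}.

Lemma sup_image_ge0 (T : Type) (A : set T) (g : T -> R) :
  (forall v, 0 <= g v) -> 0 <= sup [set g v | v in A].
Proof.
move=> g0.
have [hs|hs] := pselect (has_sup [set g v | v in A]); last by rewrite sup_out.
have [[_ [v Av _]] ub] := hs.
by apply: le_trans (g0 v) _; apply: ub_le_sup => //; exists v.
Qed.

Lemma sup_image_sqr_le (T : Type) (A : set T) (g : T -> R) (B D : R) :
  (forall v, 0 <= g v) -> (forall v, A v -> g v <= B) ->
  sup [set g v | v in A] <= D -> sup [set g v ^+ 2 | v in A] <= D ^+ 2.
Proof.
move=> g0 gB sD; have D0 := le_trans (sup_image_ge0 A g0) sD.
have [[v0 Av0]|A0] := pselect (A !=set0); last first.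
  suff -> : [set g v ^+ 2 | v in A] = set0 by rewrite sup0 sqr_ge0.
  by apply/seteqP; split=> // t [v Av _]; apply: A0; exists v.
apply: ge_sup; first by exists (g v0 ^+ 2), v0.
move=> _ [v Av <-]; rewrite ler_pXn2r ?nnegrE//; apply: le_trans sD.
by apply: ub_le_sup; [exists B => _ [w Aw <-]; exact: gB|exists v].
Qed.

Lemma le_sup_image (T : Type) (A : set T) (g : T -> R) (B : R) v :
  (forall w, A w -> g w <= B) -> A v -> g v <= sup [set g w | w in A].
Proof.
move=> gB Av; apply: ub_le_sup; last by exists v.
by exists B => _ [w Aw <-]; exact: gB.
Qed.

End Suprema.

(** * The objective and its partial maximum *)

Section Objective.
Context {R : realType} {m dx dy : nat}.
Context (X U : set 'rV[R]_dx) (Y V : set 'rV[R]_dy)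
  (f : 'I_m -> 'rV[R]_dx -> 'rV[R]_dy -> R).
Hypothesis hf : forall i, convex_concave U V (f i).
Local Notation F := (sum_cost f).

Lemma convex_functionW (E : lmodType R) (A B : set E) (g : E -> R) :
  A `<=` B -> convex_function B g -> convex_function A g.
Proof.
move=> AB /convex_functionE cg; apply/convex_functionE => x y t t01 Ax Ay.
by apply: cg => //; exact: AB.
Qed.

Lemma stackedW q (A B : set 'rV[R]_q) :
  A `<=` B -> (stacked A : set 'M[R]_(m, q)) `<=` stacked B.
Proof. by move=> AB x Ax i; exact/AB/Ax. Qed.

Lemma sum_cost_convexl y :
  stacked V y -> convex_function (stacked U) (fun x => F x y).
Proof.
move=> Vy; apply/convex_functionE => x x' t t01 Ux Ux'.
rewrite /sum_cost !mulr_sumr -big_split; apply: ler_sum => i _ /=.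
rewrite linearD !linearZ /=.
have /convex_functionE := (hf i).1 _ (Vy i).
by apply.
Qed.

Lemma sum_cost_convexr x :
  stacked U x -> convex_function (stacked V) (fun y => - F x y).
Proof.
move=> Ux; apply/convex_functionE => y y' t t01 Vy Vy'.
rewrite /sum_cost !mulrN -opprD lerN2 !mulr_sumr -big_split.
apply: ler_sum => i _ /=; rewrite linearD !linearZ /=.
have /convex_functionE := (hf i).2 _ (Ux i).
by move=> /(_ (row i y) (row i y') t t01 (Vy i) (Vy' i)); lra.
Qed.

Lemma sum_cost_bounded_above x : convex_set V -> Y `<=` V -> bounded_set Y ->
  stacked U x -> exists B, forall y, stacked Y y -> F x y <= B.
Proof.
move=> cV YV bY Ux.
have lb i : exists B, forall y, Y y -> B <= - f i (row i x) y.
  by apply: convex_bounded_below cV _ YV bY; exact: (hf i).2.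
have [B hB] := choice lb; exists (\sum_i - B i) => y Yy.
by apply: ler_sum => i _; rewrite lerNr; exact: hB.
Qed.

End Objective.

(** Along the segment from a to b the perturbation is of second order in t, so
    the subgradient inequality for f holds for g to first order; convexity of g
    then gives it at b. *)
Lemma subdiff_perturb {R : realType} p q (A : set 'M[R]_(p, q))
    (f g : 'M[R]_(p, q) -> R) (a v : 'M[R]_(p, q)) :
  convex_function A g -> A a -> convex_set A -> f a = g a ->
  (forall b, A b -> exists C, forall t, 0 <= t <= 1 ->
     f (t *: b + (1 - t) *: a) <= g (t *: b + (1 - t) *: a) + C * t ^+ 2) ->
  subdiff A f a v -> subdiff A g a v.
Proof.
move=> /convex_functionE cg Aa /convex_setE cA fga fC vf b Ab.
have [C hC] := fC b Ab; rewrite -subr_ge0.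
apply: (@first_order_ge0 _ _ C) => t /andP[t0 t1].
have t01 : 0 <= t <= 1 by rewrite ltW.
have := vf _ (cA _ _ _ t01 Ab Aa); have := cg _ _ _ t01 Ab Aa; have := hC _ t01.
have -> : t *: b + (1 - t) *: a - a = t *: (b - a).
  by rewrite scalerBl scale1r scalerBr addrA addrAC addrK.
rewrite dotmZr fga; lra.
Qed.

Section PartialMax.
Context {R : realType} {m dx dy : nat}.
Context (X U : set 'rV[R]_dx) (Y V : set 'rV[R]_dy)
  (f : 'I_m -> 'rV[R]_dx -> 'rV[R]_dy -> R).
Hypotheses (cX : convex_set X) (cU : convex_set U) (cV : convex_set V)
  (XU : X `<=` U) (YV : Y `<=` V) (bY : bounded_set Y)
  (hf : forall i, convex_concave U V (f i)).
Context (Wx : 'M[R]_(m * dx)) (Wy : 'M[R]_(m * dy)) (Ra Rb eps : R).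
Context (y0 : 'M[R]_(m, dy)).
Hypothesis Yy0 : stacked Y y0.
Local Notation F := (sum_cost f).
Local Notation FR := (penalized Wx Wy Ra Rb eps F).
Local Notation fmax := (max_over Y FR).
Local Notation Px x := (Ra ^+ 2 / eps * norm2 (mulW Wx x) ^+ 2).

Hypothesis eps0 : 0 < eps.

Lemma fmax_ge x y : stacked U x -> stacked Y y -> FR x y <= fmax x.
Proof.
move=> Ux Yy; have [B hB] := sum_cost_bounded_above hf cV YV bY Ux.
apply: (@le_sup_image _ _ _ _ (B + Px x)) => // y' Yy'.
have := hB _ Yy'; have : 0 <= Rb ^+ 2 / eps * norm2 (mulW Wy y') ^+ 2.
  by rewrite mulr_ge0 ?sqr_ge0// divr_ge0 ?sqr_ge0// ltW.
rewrite /penalized; lra.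
Qed.

Lemma fmax_le x c : (forall y, stacked Y y -> FR x y <= c) -> fmax x <= c.
Proof.
by move=> hc; apply: ge_sup => [|_ [y Yy <-]]; [exists (FR x y0), y0|exact: hc].
Qed.

(** Without its own penalty, the partial maximum is a supremum of functions
    convex in x. *)
Lemma fmax_convex : convex_function (stacked U) (fun x => fmax x - Px x).
Proof.
apply/convex_functionE => x x' t t01 Ux Ux'.
rewrite lerBlDr; apply: fmax_le => y Yy.
have := fmax_ge Ux Yy; have := fmax_ge Ux' Yy; rewrite /penalized.
have /convex_functionE/(_ x x' t t01 Ux Ux') :=
  sum_cost_convexl hf (stackedW YV Yy).
move: t01 => /andP[t0 t1]; have t10 : 0 <= 1 - t by rewrite subr_ge0.
by move=> h /(ler_wpM2l t10) h1 /(ler_wpM2l t0) h2; lra.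
Qed.

(** A positive Ra comes from a nonempty set of subgradients and a nonzero
    lambda_minp, since the supremum of the empty set and the inverse of 0 are 0.
    The penalty of x has
    a zero gradient at xs, so fmax and fmax minus this penalty have the same
    subgradients there, and the second function is the one to compare. *)
Lemma fmax_exact (e : rel 'I_m) Wt (xs : 'M[R]_(m, dx)) (B : R) :
  gossip_matrix e Wt -> is_psd_sqrt (Wt *t 1%:M) Wx ->
  is_argmin (consensus X Wx) fmax xs -> 0 < Ra ->
  (forall v, subdiff (stacked U) fmax xs v -> norm2 v <= B) ->
  Ra ^+ 2 = sup [set norm2 v ^+ 2 | v in subdiff (stacked U) fmax xs]
            / lambda_minp (Wx^T *m Wx) ->
  forall x, stacked X x -> fmax xs + Px x <= fmax x + Ra * norm2 (mulW Wx x).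
Proof.
move=> gW sW [Cxs xsmin] Ra0 vB RaE x Xx.
have [Xxs Wxs] := Cxs; have Uxs := stackedW XU Xxs.
set S := subdiff _ _ _ in vB RaE *; set l := lambda_minp _ in RaE *.
have Ra2 : Ra ^+ 2 != 0 by rewrite expf_neq0// gt_eqF.
have l0 : l != 0 by apply: contraNneq Ra2 => l0; rewrite RaE l0 invr0 mulr0.
have Pxs : Px xs = 0 by rewrite Wxs sqr_norm2 dotm0l mulr0.
have [v0 Sv0] : S !=set0.
  apply/set0P; apply: contraNneq Ra2 => S0.
  by rewrite RaE S0 image_set0 sup0 mul0r.
have P0 b : 0 <= Px b by rewrite mulr_ge0 ?sqr_ge0// divr_ge0 ?sqr_ge0// ltW.
pose g z := fmax z - Px z.
have gf v : subdiff (stacked U) g xs v -> S v.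
  move=> gv b Ub; have := gv b Ub; have := P0 b; rewrite /g Pxs; lra.
have gv0 : subdiff (stacked U) g xs v0.
  apply: (subdiff_perturb fmax_convex _ _ _ _ Sv0) => //.
  - exact: convex_stacked.
  - by rewrite Pxs subr0.
  - move=> b Ub; exists (Px b) => t _; rewrite mulWD !mulWZ Wxs scaler0 addr0.
    by rewrite norm2Z exprMn real_normK ?num_real//; lra.
have gmin : is_argmin (consensus X Wx) g xs.
  split=> // c Cc; have := xsmin c Cc; rewrite /g Pxs.
  by have [_ ->] := Cc; rewrite sqr_norm2 dotm0l; lra.
have := @exact_penalty _ _ _ e Wt Wx X U g xs v0 Ra gW sW cX XU cU fmax_convex
  gmin (ltW Ra0) gv0.
move=> /(_ _ x Xx); rewrite /g Pxs => H.
suff : forall v, subdiff (stacked U) g xs v -> norm2 v ^+ 2 <= Ra ^+ 2 * l.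
  by move=> /H; lra.
move=> v /gf Sv; rewrite RaE divfK//.
apply: (@le_sup_image _ _ S (fun v => norm2 v ^+ 2) (B ^+ 2)) => // w Sw.
have B0 : 0 <= B by exact: le_trans (norm2_ge0 _) (vB _ Sw).
by rewrite ler_pXn2r ?nnegrE ?norm2_ge0//; exact: vB.
Qed.

End PartialMax.

(** With s = r * n the hypothesis factors as (s - 2 eps) (s + eps) <= 0. *)
Lemma quadratic_penalty_bound {R : realFieldType} (eps r n : R) :
  0 < eps -> 0 < r -> 0 <= n ->
  r ^+ 2 / eps * n ^+ 2 - r * n <= 2 * eps -> n <= 2 * eps / r.
Proof.
move=> e0 r0 n0.
have -> : r ^+ 2 / eps * n ^+ 2 = (r * n) ^+ 2 / eps by field; rewrite gt_eqF.
rewrite lerBlDr ler_pdivrMr// ler_pdivlMr// mulrC.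
have : 0 <= r * n by rewrite mulr_ge0// ltW.
move: (r * n) => s s0; rewrite leNgt expr2 => h; rewrite leNgt; apply/negP => h2.
move/negP: h; apply; nra.
Qed.

(** * Complexity *)

Section Counts.
Context {R : realType} (L M : R).
Hypotheses (L0 : 0 < L) (M0 : 0 <= M).

Lemma mps_T_le k : (mps_T L M k)%:R <= 1 + k%:R * M / L.
Proof.
have x0 : 0 <= k%:R * M / L by rewrite divr_ge0 ?mulr_ge0// ltW.
rewrite /mps_T; set x := _ / L in x0 *.
have c0 : 0 <= Num.ceil x by rewrite ceil_ge0// (lt_le_trans _ x0).
have cx : (`|Num.ceil x|%N)%:R <= 1 + x.
  rewrite natr_absz ger0_norm// addrC -lerBlDr ltW//.
  by have := ceilB1_lt x; rewrite rmorphB /= mulr1z.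
by rewrite natr_max ge_max cx lerDl x0.
Qed.

Lemma nb_roundsE N : nb_rounds N = N.
Proof. by rewrite /nb_rounds sum_nat_const_nat muln1 subn1. Qed.

Lemma nb_grads_le N :
  (nb_grads (mps_T L M) N)%:R <= 2 * N%:R * (1 + N%:R * M / L).
Proof.
rewrite /nb_grads big_add1 big_mkord natr_sum.
have -> : 2 * N%:R * (1 + N%:R * M / L) =
    \sum_(k < N) (2 * (1 + N%:R * M / L)).
  by rewrite sumr_const card_ord -[RHS]mulr_natl; ring.
apply: ler_sum => k _; rewrite sum_nat_const_nat subn1 natrM mulrC ler_pM2l//.
apply: (le_trans (mps_T_le _)); rewrite lerD2l.
by rewrite ler_pM2r ?invr_gt0// ler_wpM2r// ler_nat.
Qed.

End Counts.

Theorem theorem3p6 :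
  exists C : nat,
  forall (R : realType) (m dx dy : nat)
    (* feasible sets, domains of the node functions, node functions *)
    (X U : set 'rV[R]_dx) (Y V : set 'rV[R]_dy)
    (f : 'I_m -> 'rV[R]_dx -> 'rV[R]_dy -> R)
    (hXclosed : closed X) (hXconvex : convex_set X) (hXbounded : bounded_set X)
    (hYclosed : closed Y) (hYconvex : convex_set Y) (hYbounded : bounded_set Y)
    (hU : convex_set U) (hXU : X `<=` U) (hV : convex_set V) (hYV : Y `<=` V)
    (hf : forall i, convex_concave U V (f i))
    (* graph and gossip matrices *)
    (e : rel 'I_m) (he : connected_graph e)
    (Wtx Wty : 'M[R]_m) (hWtx : gossip_matrix e Wtx) (hWty : gossip_matrix e Wty)
    (Wx : 'M[R]_(m * dx)) (hWx : is_psd_sqrt (Wtx *t 1%:M) Wx)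
    (Wy : 'M[R]_(m * dy)) (hWy : is_psd_sqrt (Wty *t 1%:M) Wy)
    (* accuracy, penalty coefficients, constrained optima *)
    (eps : R) (heps : 0 < eps)
    (F : 'M[R]_(m, dx) -> 'M[R]_(m, dy) -> R) (hF : F = sum_cost f)
    (Ra Rb : R) (hRa0 : 0 <= Ra) (hRb0 : 0 <= Rb)
    (FR : 'M[R]_(m, dx) -> 'M[R]_(m, dy) -> R)
    (hFR : FR = penalized Wx Wy Ra Rb eps F)
    (fmax : 'M[R]_(m, dx) -> R) (hfmax : fmax = max_over Y FR)
    (xs : 'M[R]_(m, dx)) (hxs : is_argmin (consensus X Wx) fmax xs)
    (ys : 'M[R]_(m, dx) -> 'M[R]_(m, dy))
    (hys : forall x, stacked X x -> is_argmax (consensus Y Wy) (FR x) (ys x))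
    (hRa : Ra ^+ 2 =
       sup [set norm2 v ^+ 2 | v in subdiff (stacked U) fmax xs]
         / lambda_minp (Wx^T *m Wx))
    (hRb : Rb ^+ 2 =
       sup [set sup [set norm2 v ^+ 2 |
                      v in subdiff (stacked V) (fun y => - F x y) (ys x)]
                  / lambda_minp (Wy^T *m Wy) | x in stacked X])
    (* constants; the two subgradient bounds entering D are finite *)
    (hfin1 : exists B : R, forall v, subdiff (stacked U) fmax xs v ->
       norm2 v <= B)
    (hfin2 : exists B : R, forall x v, stacked X x ->
       saddle_subdiff U V F x (ys x) v -> norm2z v <= B)
    (D : R)
    (hD : D = Num.max
       (sup [set norm2 v | v in subdiff (stacked U) fmax xs])
       (sup [set sup [set norm2z v | v in saddle_subdiff U V F x (ys x)] |
              x in stacked X]))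
    (chi : R) (hchi : chi = Num.max (cond_number Wx) (cond_number Wy))
    (* subgradient operator: component h i at node i *)
    (h : 'I_m -> 'rV[R]_dx * 'rV[R]_dy -> 'rV[R]_dx * 'rV[R]_dy)
    (hh : forall z, (stacked X `*` stacked Y) z ->
       saddle_subdiff U V F z.1 z.2 (operator h z))
    (* prox-function, with gradient gd on Z *)
    (d : 'rV[R]_dx * 'rV[R]_dy -> R)
    (gd : 'rV[R]_dx * 'rV[R]_dy -> 'rV[R]_dx * 'rV[R]_dy)
    (hgd : forall z, (X `*` Y) z -> is_gradient (X `*` Y) d z (gd z))
    (hd : strongly_convex1 (X `*` Y) d)
    (* relaxed smoothness of the operator *)
    (delta M : R) (hdelta : 0 <= delta) (hM : 0 <= M)
    (hH : forall z1 z2 z3, (stacked X `*` stacked Y) z1 ->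
       (stacked X `*` stacked Y) z2 -> (stacked X `*` stacked Y) z3 ->
       dotz (operator h z1 - operator h z2) (z1 - z3) <=
         M / 2 * norm2z (z1 - z2) ^+ 2 + M / 2 * norm2z (z1 - z3) ^+ 2 + delta)
    (hepsdelta : delta <= eps)
    (L : R) (hL : L = 2 * D ^+ 2 / eps * chi)
    (* starting point and regime *)
    (z0 : 'M[R]_(m, dx) * 'M[R]_(m, dy)) (hz0 : (stacked X `*` stacked Y) z0)
    (Omega : R)
    (hOmega : Omega = Num.sqrt
       (sup [set bregman_sum d gd z0 z | z in stacked X `*` stacked Y]))
    (hregime : 1 <= D * Omega * Num.sqrt chi / eps),
  exists N : nat,
    [/\ (nb_rounds N)%:R <= C%:R * (D * Omega / eps * Num.sqrt chi),
        (nb_grads (mps_T L M) N)%:R <=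
          C%:R * ((M * Omega ^+ 2 + D * Omega * Num.sqrt chi) / eps)
      & forall (zu z zt zb gG : nat -> 'M[R]_(m, dx) * 'M[R]_(m, dy))
          (zin ztin : nat -> nat -> 'M[R]_(m, dx) * 'M[R]_(m, dy)),
        mps_run (X `*` Y) (bregman d gd) h (penalty Wx Wy Ra Rb eps)
          (mps_T L M) (mps_beta L) mps_gamma (mps_eta L M) z0 N
          zu z zt zb gG zin ztin ->
        [/\ sup [set F (zb N).1 y | y in consensus Y Wy]
              - inf [set F x (zb N).2 | x in consensus X Wx] <= 2 * eps,
            0 < Ra -> norm2 (mulW Wx (zb N).1) <= 2 * eps / Ra
          & 0 < Rb -> norm2 (mulW Wy (zb N).2) <= 2 * eps / Rb]].
Proof.
exists 25%N => R m dx dy X U Y V f _ cX _ _ cY bY cU XU cV YV hf e _ Wtx Wty gWx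
  gWy Wx sWx Wy sWy eps eps0 _ -> Ra Rb Ra0 Rb0 _ -> _ -> xs xsmin ys ysmax RaE RbE
  [B1 hB1] [B2 hB2] D DE chi chiE h hh d gd dgd dsc delta M delta0 M0 hH deps L LE
  z0 Zz0 Omega OmegaE regime.
set F := sum_cost f in xsmin ysmax RaE RbE hB1 hB2 DE hh *.
set FR := penalized _ _ _ _ _ _ in xsmin ysmax RaE hB1 DE.
set fmax := max_over _ _ in xsmin RaE hB1 DE.
have [Xz0 Yz0] := Zz0.
have hZ x : stacked X x -> (stacked X `*` stacked Y) (x, ys x).
  by move=> Xx; split=> //; have [[]] := ysmax x Xx.
have D1 : sup [set norm2 v | v in subdiff (stacked U) fmax xs] <= D.
  by rewrite DE le_max lexx.
have D0 : 0 <= D by apply: le_trans D1; apply: sup_image_ge0 => v; exact: norm2_ge0.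
have D2 x v : stacked X x ->
    subdiff (stacked V) (fun y => - F x y) (ys x) v -> norm2 v <= D.
  move=> Xx Sv; have [hx _] := hh _ (hZ x Xx).
  have Sxv : saddle_subdiff U V F x (ys x) ((operator h (x, ys x)).1, v) by [].
  apply: (le_trans (norm2_le_norm2z ((operator h (x, ys x)).1, v))).
  apply: (@le_trans _ _ (sup [set norm2z v | v in saddle_subdiff U V F x (ys x)])).
    by apply: (@le_sup_image _ _ _ _ B2) => // w; exact: hB2.
  rewrite DE le_max; apply/orP; right.
  pose s x := sup [set norm2z v | v in saddle_subdiff U V F x (ys x)].
  apply: (@le_sup_image _ _ (stacked X) s B2) => // x' Xx'.
  apply: ge_sup => [|_ [w Sw <-]]; last exact: hB2 Sw.
  by eexists; exists (operator h (x', ys x')) => //; exact: hh _ (hZ x' Xx').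
have lx0 := gram_lambda_minp_ge0 Wx; have ly0 := gram_lambda_minp_ge0 Wy.
have Lx0 := gram_lambda_max_ge0 Wx; have Ly0 := gram_lambda_max_ge0 Wy.
have sx : sup [set norm2 v ^+ 2 | v in subdiff (stacked U) fmax xs] <= D ^+ 2.
  by apply: (sup_image_sqr_le (B := B1)) => // v; exact: norm2_ge0.
pose sy x := sup [set norm2 v ^+ 2 |
  v in subdiff (stacked V) (fun y => - F x y) (ys x)] / lambda_minp (Wy^T *m Wy).
have syD x : stacked X x -> sy x <= D ^+ 2 / lambda_minp (Wy^T *m Wy).
  move=> Xx; rewrite ler_wpM2r ?invr_ge0//.
  apply: (sup_image_sqr_le (B := D)) => [v|v|]; first exact: norm2_ge0.
    exact: D2.
  apply: ge_sup => [|_ [w Sw <-]]; last exact: D2 Sw.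
  by exists (norm2 (operator h (x, ys x)).2), (operator h (x, ys x)).2 => //;
    have [] := hh _ (hZ x Xx).
have RaD : Ra ^+ 2 * lambda_max (Wx^T *m Wx) <= D ^+ 2 * chi.
  apply: (@le_trans _ _ (D ^+ 2 * cond_number Wx)).
    by rewrite /cond_number RaE mulrAC -mulrA ler_wpM2r// divr_ge0.
  by rewrite ler_wpM2l ?sqr_ge0// chiE le_max lexx.
have RbD : Rb ^+ 2 * lambda_max (Wy^T *m Wy) <= D ^+ 2 * chi.
  apply: (@le_trans _ _ (D ^+ 2 * cond_number Wy)).
    rewrite /cond_number mulrA [leRHS]mulrAC ler_wpM2r// RbE.
    apply: ge_sup => [|_ [x Xx <-]]; last exact: syD.
    by exists (sy z0.1), z0.1.
  by rewrite ler_wpM2l ?sqr_ge0// chiE le_max lexx orbT.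
(* A vanishes as soon as D, Omega or chi does.  As 0 is the default value of sup,
   this makes the supremum defining Omega a genuine one. *)
set A := D * Omega * Num.sqrt chi / eps in regime.
have A0 : 0 < A := lt_le_trans ltr01 regime.
have An0 : A != 0 by rewrite gt_eqF.
have D_gt0 : 0 < D.
  by rewrite lt_neqAle D0 andbT; apply: contraNneq An0 => z; rewrite /A -z !mul0r.
have O_gt0 : 0 < Omega.
  rewrite lt_neqAle {2}OmegaE sqrtr_ge0 andbT.
  by apply: contraNneq An0 => z; rewrite /A -z mulr0 !mul0r.
have chi_gt0 : 0 < chi.
  rewrite -sqrtr_gt0 lt_neqAle sqrtr_ge0 andbT.
  by apply: contraNneq An0 => z; rewrite /A -z mulr0 !mul0r.
have L0 : 0 < L by rewrite LE mulr_gt0// divr_gt0// mulr_gt0// exprn_gt0.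
have LO : L * Omega ^+ 2 = 2 * eps * A ^+ 2.
  rewrite LE /A !exprMn sqr_sqrtr ?ltW// exprVn; field.
  by rewrite gt_eqF.
set SV := [set bregman_sum d gd z0 z | z in _] in OmegaE.
have VO w : (stacked X `*` stacked Y) w -> bregman_sum d gd z0 w <= Omega ^+ 2.
  move=> Zw; have supV : 0 < sup SV by rewrite -sqrtr_gt0 -OmegaE.
  rewrite OmegaE (sqr_sqrtr (ltW supV)); apply: ub_le_sup; last by exists w.
  have [[_ ub]//|ns] := pselect (has_sup SV).
  by move: supV; rewrite sup_out// ltxx.
(* The rate asks for 6 L Omega ^+ 2 = 12 eps A ^+ 2 <= N (N + 1) eps. *)
pose N := (Num.truncn (4 * A)).+1.
have N4 : 4 * A <= N%:R by rewrite ltW// truncnS_gt.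
have N5 : N%:R <= 5 * A.
  have : (Num.truncn (4 * A))%:R <= 4 * A by rewrite truncn_le// mulr_ge0// ltW.
  by rewrite /N -natr1; lra.
exists N; split.
- rewrite nb_roundsE (le_trans N5)//.
  have -> : D * Omega / eps * Num.sqrt chi = A by rewrite /A mulrAC.
  by rewrite ler_wpM2r ?ler_nat// ltW.
- apply: (le_trans (nb_grads_le L0 M0 N)).
  have -> : (M * Omega ^+ 2 + D * Omega * Num.sqrt chi) / eps
      = M * Omega ^+ 2 / eps + A by rewrite mulrDl.
  have ML : M / L * A ^+ 2 = M * Omega ^+ 2 / (2 * eps).
    have -> : A ^+ 2 = L * Omega ^+ 2 / (2 * eps).
      by rewrite LO; field; rewrite gt_eqF.
    by field; rewrite !gt_eqF.
  have ML0 : 0 <= M / L by rewrite divr_ge0// ltW.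
  have N2 : N%:R ^+ 2 <= 25 * A ^+ 2.
    have -> : 25 * A ^+ 2 = (5 * A) ^+ 2 by ring.
    by rewrite ler_pXn2r ?nnegrE ?ler0n// (le_trans _ N5).
  have := ler_wpM2l ML0 N2; rewrite [X in _ <= X -> _]mulrCA ML.
  have -> : M * Omega ^+ 2 / (2 * eps) = M * Omega ^+ 2 / eps / 2.
    by field; rewrite gt_eqF.
  lra.
move=> zu z zt zb gG zin ztin run.
have penL w : penalty Wx Wy Ra Rb eps w <= L / 2 * norm2z w ^+ 2.
  (* L / 2 dominates R ^+ 2 lambda_max / eps, as R ^+ 2 <= D ^+ 2 / lambda_minp. *)
  have coef n (W : 'M[R]_n) r (u : 'cV[R]_n) :
      r ^+ 2 * lambda_max (W^T *m W) <= D ^+ 2 * chi ->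
      r ^+ 2 / eps * norm2 (W *m u) ^+ 2 <= L / 2 * dotm u u.
    move=> rD; apply: (@le_trans _ _ (r ^+ 2 / eps *
        (lambda_max (W^T *m W) * dotm u u))).
      by rewrite ler_wpM2l ?gram_lambda_max_ge// divr_ge0 ?sqr_ge0// ltW.
    rewrite mulrA ler_wpM2r ?dotm_ge0// mulrAC.
    have -> : L / 2 = D ^+ 2 * chi / eps by rewrite LE; field; rewrite gt_eqF.
    by rewrite ler_pM2r ?invr_gt0.
  rewrite sqr_norm2z mulrDr; apply: lerD.
    by rewrite -dotm_flat; exact: coef.
  by rewrite -dotm_flat; exact: coef.
have Fx y : stacked Y y -> convex_function (stacked X) (fun x => F x y).
  move=> Yy; apply: (@convex_functionW _ _ _ (stacked U)).
    exact: stackedW.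
  by apply: (sum_cost_convexl hf); exact: stackedW Yy.
have Fy x : stacked X x -> convex_function (stacked Y) (fun y => - F x y).
  move=> Xx; apply: (@convex_functionW _ _ _ (stacked V)).
    exact: stackedW.
  by apply: (sum_cost_convexr hf); exact: stackedW Xx.
have Fh w : (stacked X `*` stacked Y) w ->
    saddle_subdiff X Y F w.1 w.2 (operator h w).
  by move=> /hh[hx hy]; split=> b Zb; [apply: hx|apply: hy]; exact: stackedW Zb.
have main w : (stacked X `*` stacked Y) w ->
    FR (zb N).1 w.2 - FR w.1 (zb N).2 <= 2 * eps.
  move=> Zw.
  have := mps_rate cX cY dgd dsc Fx Fy Fh M0 hH L0 (penalty_ge0 Wx Wy Ra Rb eps0)
    penL (@penalty_expansion _ _ _ _ Wx Wy Ra Rb eps) _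
    (penalty_convex Wx Wy Ra Rb eps0) Zz0 run Zw.
  have penZ (s : R) u :
      penalty Wx Wy Ra Rb eps (s *: u) = s ^+ 2 * penalty Wx Wy Ra Rb eps u.
    by rewrite /penalty /= !mulWZ !norm2Z !exprMn !real_normK ?num_real//; ring.
  move=> /(_ penZ).
  have N0 : 0 < N%:R * (N%:R + 1) :> R by rewrite mulr_gt0// ltr_wpDl.
  have VO6 : 6 * L * bregman_sum d gd z0 w <= N%:R * (N%:R + 1) * eps.
    apply: (@le_trans _ _ (6 * L * Omega ^+ 2)).
      by rewrite ler_pM2l ?mulr_gt0//; exact: VO.
    rewrite -mulrA LO.
    have N16 : 16 * A ^+ 2 <= N%:R ^+ 2.
      have -> : 16 * A ^+ 2 = (4 * A) ^+ 2 by ring.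
      by rewrite ler_pXn2r ?nnegrE ?ler0n// mulr_ge0// ltW.
    have := ler_wpM2r (ltW eps0) N16.
    have : 0 <= A ^+ 2 * eps by rewrite mulr_ge0 ?sqr_ge0// ltW.
    have : 0 <= N%:R * eps by rewrite mulr_ge0// ltW.
    lra.
  have de : N%:R * (N%:R + 1) * delta <= N%:R * (N%:R + 1) * eps.
    by rewrite ler_pM2l.
  move=> rate; rewrite -(ler_pM2l N0); apply: le_trans (_ : _ <= _ * eps + _ * eps) _.
    apply: le_trans (lerD VO6 de); apply: le_trans rate.
    rewrite ler_pM2l// /gap /FR /penalized /penalty; lra.
  lra.
have Zb : (stacked X `*` stacked Y) (zb N) by exact: (zb_mem cX cY Zz0 run (leqnn N)).
have [Xb Yb] := Zb.
have W0 q (W : 'M[R]_(m * q)) B x : consensus B W x -> norm2 (mulW W x) ^+ 2 = 0.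
  by move=> [_ ->]; rewrite sqr_norm2 dotm0l.
split.
- have gap2 x y : consensus X Wx x -> consensus Y Wy y ->
      F (zb N).1 y - F x (zb N).2 <= 2 * eps.
    move=> Cx Cy; have := main (x, y) (conj Cx.1 Cy.1).
    have := penalty_ge0 Wx Wy Ra Rb eps0 (zb N).
    rewrite /FR /penalized /penalty /= (W0 _ _ _ _ Cx) (W0 _ _ _ _ Cy); lra.
  rewrite lerBlDr -lerBlDl; apply: lb_le_inf.
    by exists (F xs (zb N).2), xs => //; case: xsmin.
  move=> _ [x Cx <-]; rewrite lerBlDl; apply: ge_sup.
    exists (F (zb N).1 (ys z0.1)), (ys z0.1) => //.
    by case: (ysmax _ Xz0).
  by move=> _ [y Cy <-]; rewrite -lerBlDr; exact: gap2.
- move=> Ra_gt0; apply: quadratic_penalty_bound => //; first exact: norm2_ge0.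
  have := fmax_exact cX cU cV XU YV bY hf Yz0 eps0 gWx sWx xsmin Ra_gt0 hB1 RaE Xb.
  rewrite -/F -/FR -/fmax => exact_x.
  have Xs : stacked X xs by case: xsmin => -[].
  suff : fmax (zb N).1 <= 2 * eps + fmax xs by lra.
  apply: (fmax_le Yz0) => y Yy; have := main (xs, y) (conj Xs Yy) => /= h1.
  have := fmax_ge cV YV bY hf Wx Wy Ra Rb eps0 (stackedW XU Xs) Yb.
  rewrite -/F -/FR -/fmax; lra.
move=> Rb_gt0; apply: quadratic_penalty_bound => //; first exact: norm2_ge0.
have [Cys yb] := ysmax _ Xb.
have RbN : Rb ^+ 2 != 0 by rewrite expf_neq0// gt_eqF.
have ly_neq0 : lambda_minp (Wy^T *m Wy) != 0.
  apply: contraNneq RbN => l0; rewrite RbE l0 invr0.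
  suff -> : [set sup [set norm2 v ^+ 2 | v in
      subdiff (stacked V) (fun y => - F x y) (ys x)] * 0 | x in stacked X] = [set 0].
    by rewrite sup1.
  apply/seteqP; split=> [_ [x _ <-]|_ ->]; first by rewrite mulr0.
  by exists z0.1; rewrite ?mulr0.
have ymin : is_argmin (consensus Y Wy) (fun y => - F (zb N).1 y) (ys (zb N).1).
  split=> // c Cc; have := yb c Cc.
  rewrite /FR /penalized (W0 _ _ _ _ Cys) (W0 _ _ _ _ Cc); lra.
have [_ Sv0] := hh _ (hZ _ Xb).
have ex : - F (zb N).1 (ys (zb N).1) <= - F (zb N).1 (zb N).2
    + Rb * norm2 (mulW Wy (zb N).2).
  apply: (exact_penalty gWy sWy cY YV cV (sum_cost_convexr hf (stackedW XU Xb))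
    ymin Rb0 Sv0 _ Yb) => v Sv.
  apply: (@le_trans _ _ (sy (zb N).1 * lambda_minp (Wy^T *m Wy))).
    rewrite divfK//.
    apply: (@le_sup_image _ _ _ (fun v => norm2 v ^+ 2) (D ^+ 2)) => // w Sw.
    by rewrite ler_pXn2r ?nnegrE ?norm2_ge0//; exact: D2 Sw.
  rewrite ler_wpM2r// RbE; exact: (@le_sup_image _ _ (stacked X) sy _ _ syD).
(* Comparing with (xb, ys xb) instead of a saddle point removes the penalty of x
   from both sides. *)
have := main ((zb N).1, ys (zb N).1) (conj Xb Cys.1).
rewrite /FR /penalized /= (W0 _ _ _ _ Cys); lra.
Qed.
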